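(* Let $-\infty\le a<b\le\infty$ and let $A:(a,b)\to\mathbb{R}^{n\times n}$ be a matrix of measurable, locally essentially bounded functions with entries $a_{ij}(t)$. Suppose that $A(t)\in\mathbb{M}^+$ for almost all $t\in(a,b)$ and, furthermore, that there exists $\delta>0$ such that $a_{ij}(t)\ge\delta$ for all $i,j$ with $|i-j|=1$ and almost all $t\in(a,b)$. Then the system $$\frac{d}{dt}\Phi(t,t_0)=A(t)\Phi(t,t_0),\qquad \Phi(t_0,t_0)=I,$$ is a totally positive differential system (TPDS) on $(a,b)$.
   Context: A square real matrix is totally positive (TP) if the determinant of every square submatrix (every minor) is positive. For $a<t_0,t<b$, $\Phi(t,t_0)$ denotes the unique locally absolutely continuous solution of the displayed equation (holding for almost every $t$). The system is called a TPDS on $(a,b)$ if $\Phi(t,t_0)$ is TP for all $a<t_0<t<b$. $\mathbb{M}^+\subset\mathbb{R}^{n\times n}$ denotes the set of tridiagonal matrices with positive entries on the sub-diagonal and the super-diagonal (the diagonal entries are arbitrary real numbers). *)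

(* Defs.v *)
From mathcomp Require Import all_boot all_order all_algebra.
From mathcomp Require Import all_classical all_reals all_analysis.
From mathcomp Require Import measurable_realfun ess_sup_inf.

Set Implicit Arguments.
Unset Strict Implicit.
Unset Printing Implicit Defensive.

Import Order.TTheory GRing.Theory Num.Theory.
Import numFieldNormedType.Exports.

Local Open Scope classical_set_scope.
Local Open Scope ring_scope.

Definition oitv (R : realType) (a b : \bar R) : set R :=
  [set t | (a < t%:E < b)%E].

(* The case k = 0 is harmless: the empty minor is 1. *)
Definition totally_positive (R : realType) (n : nat) (M : 'M[R]_n) : Prop :=
  forall (k : nat) (f g : 'I_k -> 'I_n),
    {homo f : i j / (i < j)%N} -> {homo g : i j / (i < j)%N} ->
    0 < \det (mxsub f g M).

Definition Mplus (R : realType) (n : nat) : set 'M[R]_n :=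
  [set M : 'M[R]_n |
    (forall i j : 'I_n, `|i%:Z - j%:Z| = 1 -> 0 < M i j) /\
    (forall i j : 'I_n, 1 < `|i%:Z - j%:Z| -> M i j = 0)].

(* Measurability with respect to the Lebesgue sigma-algebra, i.e. the completion
   of the Borel sigma-algebra carried by R in the library. *)
Definition lebesgue_measurable_fun (R : realType) (D : set R) (f : R -> R) :=
  @measurable_fun _ _
    (g_sigma_algebraType (completed_algebra_gen (@lebesgue_measure R))) R D f.

Definition locally_ess_bounded (R : realType) (D : set R) (f : R -> R) : Prop :=
  forall K : set R, compact K -> K `<=` D ->
    (ess_sup (@lebesgue_measure R) (fun t => `|(f \_ K) t|%:E) < +oo)%E.

Definition absolutely_continuous (R : realType) (c d : R) (f : R -> R) : Prop :=
  forall e : R, 0 < e -> exists2 r : R, 0 < r &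
    forall (m : nat) (u v : 'I_m -> R),
      (forall i, c <= u i <= v i /\ v i <= d) ->
      trivIset setT (fun i => `]u i, v i[%classic) ->
      \sum_(i < m) (v i - u i) < r ->
      \sum_(i < m) `|f (v i) - f (u i)| < e.

Definition locally_absolutely_continuous (R : realType) (D : set R)
    (f : R -> R) : Prop :=
  forall c d : R, `[c, d] `<=` D -> absolutely_continuous c d f.

Definition is_matrix_solution (R : realType) (n : nat) (a b : \bar R)
    (A : R -> 'M[R]_n) (t0 : R) (X : R -> 'M[R]_n) : Prop :=
  [/\ X t0 = 1%:M,
      forall i j, locally_absolutely_continuous (oitv a b) (fun t => X t i j) &
      \forall t \ae (@lebesgue_measure R), oitv a b t ->
        forall i j, is_derive t 1 (fun s => X s i j) ((A t *m X t) i j)].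

(* Phi t t0 is the value at t of the unique solution that is the identity at t0;
   its values outside the interval are irrelevant. *)
Definition is_transition_matrix (R : realType) (n : nat) (a b : \bar R)
    (A : R -> 'M[R]_n) (Phi : R -> R -> 'M[R]_n) : Prop :=
  forall t0, oitv a b t0 ->
    is_matrix_solution a b A t0 (Phi^~ t0) /\
    forall X, is_matrix_solution a b A t0 X ->
      forall t, oitv a b t -> X t = Phi t t0.

(* The existence and uniqueness of Phi are part of the definition, so that it
   cannot hold vacuously. *)
Definition TPDS (R : realType) (n : nat) (a b : \bar R)
    (A : R -> 'M[R]_n) : Prop :=
  exists2 Phi : R -> R -> 'M[R]_n, is_transition_matrix a b A Phi &
    forall t0 t : R, oitv a b t0 -> oitv a b t -> t0 < t ->
      totally_positive (Phi t t0).

(* Main.v *)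
Require Import Defs.
From mathcomp Require Import all_boot all_order all_algebra.
From mathcomp Require Import all_classical all_reals all_analysis.
From mathcomp Require Import perm measurable_realfun ess_sup_inf ring lra zify.

Set Implicit Arguments.
Unset Strict Implicit.
Unset Printing Implicit Defensive.

Import Order.TTheory GRing.Theory Num.Theory.
Import numFieldNormedType.Exports.

Local Open Scope classical_set_scope.
Local Open Scope ring_scope.

(* Existence is Picard iteration on compact intervals, for a Borel representative of
   [A], with uniqueness gluing the local solutions. Fix the columns [g] of a minor of
   [Phi t t0] and let its rows [f] vary over the strictly increasing sequences. By
   multilinearity the minors [p f] satisfy a linear system in which [p f] is coupled,
   with coefficient [A (f r) l], to the minor with row [f r] replaced by row [l]. As
   [A] is tridiagonal, only the neighbours [l] of [f r] matter, and then the new rows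
   are strictly increasing or contain a repetition; so all the off-diagonal couplings
   are nonnegative. Weighting by [expR (C (t - t0))] makes the diagonal ones nonnegative
   too, whence the weighted minors are nonnegative and nondecreasing. The one with
   [f = g] starts at 1, and positivity propagates along the couplings, which are bounded
   below by [delta] and connect all the strictly increasing sequences. *)

(** * Monotonicity of absolutely continuous functions *)

(** Solutions are differentiable only almost everywhere, so every estimate has to come from a
    derivative bound that holds off a null set. [ac_nondecreasing] supplies this once. Comparison
    with explicit exponentials then yields uniqueness, the contraction property of the iteration and
    the nonnegativity of the minors, each by an induction that halves a constant at every pass. The
    minors cannot be shown positive in one go: at the initial time all of them but the one with
    [f = g] vanish, and a lower bound on the derivative of one minor needs the signs of its
    neighbours. Hence nonnegativity is proved for the whole family at once; monotonicity of each
    weighted minor follows from it, and strict positivity from both. *)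

Section Monotone.
Variable R : realType.
Local Notation mu := (@lebesgue_measure R).

Lemma negligible_open_cover (N : set R) (e : R) : mu.-negligible N -> 0 < e ->
  exists U : set R, [/\ open U, N `<=` U & (mu U < e%:E)%E].
Proof.
move=> [B [mB B0 NB]] e0.
have [|U [oU BU UB]] := @lebesgue_regularity_outer R B e mB _ e0.
  by rewrite [X in (X < _)%E]B0.
exists U; split => //; first exact: subset_trans BU.
rewrite (_ : U = (U `\` B) `|` B); last by rewrite setDKU.
apply: le_lt_trans UB.
have mU : measurable U by exact: open_measurable.
rewrite (le_trans (measureU2 _ _ _))//; first exact: measurableD.
by rewrite [X in (_ + X)%E]B0 adde0.
Qed.

(** Converts a measure bound on the open set covering the exceptional points into the bound on total
    length that [absolutely_continuous] asks for. *)
Lemma sum_disjoint_itv_le (m : nat) (u v : 'I_m -> R) (U : set R) (r : R) :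
  (forall i, u i <= v i) -> (forall i, `]u i, v i[%classic `<=` U) ->
  trivIset setT (fun i => `]u i, v i[%classic) -> open U -> (mu U < r%:E)%E ->
  \sum_(i < m) (v i - u i) < r.
Proof.
move=> uv uvU triv oU Ur; rewrite -lte_fin; apply: le_lt_trans Ur.
have -> : (\sum_(i < m) (v i - u i))%:E =
    mu (\big[setU/set0]_(i < m) `]u i, v i[%classic).
  rewrite [RHS]measure_bigsetU_ord// -sumEFin; apply: eq_bigr => i _.
  rewrite [RHS](@lebesgue_measure_itv R `]u i, v i[)/= lte_fin EFinB; case: ltP => // vu.
  have -> : u i = v i by apply/le_anti; rewrite uv vu.
  by rewrite subee.
apply: le_measure; rewrite ?inE.
- by apply: bigsetU_measurable => i _; exact: measurable_itv.
- exact: open_measurable.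
- by rewrite -bigcup_seq => x [i _]; exact: uvU.
Qed.


(** A straddle estimate: [p] and [q] are each compared with [x], the only point where [f] is known
    to be differentiable. *)
Lemma is_derive_lower (f : R -> R) (x l e : R) : is_derive x 1 f l -> 0 <= l ->
  0 < e -> exists2 r, 0 < r & forall p q, x - r < p -> p <= x -> x <= q ->
    q < x + r -> - (e * (q - p)) <= f q - f p.
Proof.
move=> df l0 e0.
have /cvgrPdist_lt/(_ _ e0) : h^-1 *: (f (h + x) - f x) @[h --> 0^'] --> l.
  have [/cvg_ex[l' /= fl'] <-] := df.
  rewrite /derive; set g := (X in X @ _ --> _) in fl' *.
  have -> : (fun h => h^-1 *: (f (h + x) - f x)) = g.
    by apply/funext => h; rewrite /g /= [h%:A]mulr1.
  by rewrite (cvg_lim _ fl').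
move=> [r /= r0 H]; exists r => // p q pr px xq qr.
have key y : y != x -> `|y - x| < r -> - e < (f y - f x) / (y - x).
  move=> yx yxr; have := H (y - x); rewrite /= sub0r normrN subr_eq0 => /(_ yxr yx).
  rewrite subrK => /(le_lt_trans (ler_norm _)).
  rewrite [_ *: _]mulrC; lra.
have H1 : - (e * (q - x)) <= f q - f x.
  have [->|qx] := eqVneq q x; first by rewrite !subrr mulr0 oppr0.
  have qx0 : 0 < q - x by rewrite subr_gt0 lt_neqAle eq_sym qx.
  have := key q qx; rewrite gtr0_norm// => /(_ ltac:(lra)).
  by rewrite ltr_pdivlMr// mulNr => /ltW.
have H2 : - (e * (x - p)) <= f x - f p.
  have [->|px'] := eqVneq p x; first by rewrite !subrr mulr0 oppr0.
  have px0 : p - x < 0 by rewrite subr_lt0 lt_neqAle px'.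
  have := key p px'; rewrite ltr0_norm// => /(_ ltac:(lra)).
  rewrite ltr_ndivlMr// => /ltW; lra.
lra.
Qed.

(* The exceptional null set is covered by an open set of small measure. Walking from
   [c] to [d], [f] loses at most [e] times the length outside this set, and inside it
   the losses are controlled by absolute continuity. *)
Lemma ac_nondecreasing (c d : R) (f : R -> R) : c <= d ->
  absolutely_continuous c d f ->
  (\forall t \ae mu, c < t < d -> exists2 l, is_derive (t : R) 1 f l & 0 <= l) ->
  f c <= f d.
Proof.
move=> cd acf [N [mN N0 subN]].
(* The [1] pays for the losses inside the open cover, [d - c] for the losses at rate [e] outside
   it. *)
suff key e : 0 < e -> f c - f d <= e * (1 + (d - c)).
  have dc : 0 < 1 + (d - c) by lra.
  rewrite -subr_le0; apply/ler_addgt0Pr => e e0; rewrite add0r.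
  have := key (e / (1 + (d - c))) (divr_gt0 e0 dc).
  by rewrite divfK// gt_eqF.
move=> e0.
have [r r0 acr] := acf _ e0.
(* The endpoints join the exceptional set, since the derivative is only controlled for
   [c < t < d]. *)
have negN : mu.-negligible (N `|` [set c; d]).
  have neg1 x : mu.-negligible [set x].
    by apply/negligibleP; [exact: measurable_set1|exact: lebesgue_measure_set1].
  by apply: negligibleU; [exact/negligibleP|exact: negligibleU].
have [U [oU NU Ur]] := negligible_open_cover negN r0.
(* State of the walk at [x]: the losses so far, charged to length or to finitely many disjoint
   intervals inside [U]. Indexing by [nat] lets an interval be appended without changing the types
   of [u] and [v]. *)
pose P x := c <= x <= d /\ exists (m : nat) (u v : nat -> R),
  [/\ forall i : 'I_m, c <= u i <= v i /\ v i <= x,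
      forall i : 'I_m, `]u i, v i[%classic `<=` U,
      trivIset setT (fun i : 'I_m => `]u i, v i[%classic) &
      f c - f x <= e * (x - c) + \sum_(i < m) `|f (v i) - f (u i)|].
have Pc : P c.
  split; first by rewrite lexx cd.
  exists 0, (fun=> 0), (fun=> 0); split; do ?[by case].
  by rewrite big_ord0 !subrr mulr0 addr0.
have extend1 x y : P x -> x <= y -> y <= d -> - (e * (y - x)) <= f y - f x -> P y.
  move=> [/andP[cx xd] [m [u [v [uv uvU triv fx]]]]] xy yd fxy.
  split; first by rewrite (le_trans cx xy).
  exists m, u, v; split => //; last by lra.
  by move=> i; have [-> /le_trans] := uv i; split => //; auto.
have extend2 x y : P x -> x <= y -> y <= d -> `]x, y[%classic `<=` U -> P y.
  move=> [/andP[cx xd] [m [u [v [uv uvU triv fx]]]]] xy yd xyU.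
  split; first by rewrite (le_trans cx xy).
  exists m.+1, (fun i => if (i < m)%N then u i else x),
    (fun i => if (i < m)%N then v i else y); split.
  - move=> i; case: ifPn => im; last by rewrite cx xy.
    by have /= [-> /le_trans] := uv (Ordinal im); split => //; auto.
  - by move=> i; case: ifPn => im; [exact: (uvU (Ordinal im))|].
  - move=> i j _ _ [z []] /=.
    case: ifPn => im; case: ifPn => jm.
    + move=> zi zj; apply/val_inj.
      by have [] := triv (Ordinal im) (Ordinal jm) I I (ex_intro _ z (conj zi zj)).
    + rewrite !in_itv/= => zi zj.
      by have /= [_ vx] := uv (Ordinal im); exfalso; move: zi zj vx; clear; lra.
    + rewrite !in_itv/= => zi zj.
      by have /= [_ vx] := uv (Ordinal jm); exfalso; move: zi zj vx; clear; lra.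
    + move=> _ _; apply/val_inj; move: (ltn_ord i) (ltn_ord j); rewrite !ltnS => li lj.
      by apply/eqP; rewrite eqn_leq; apply/andP; split;
        [rewrite (leq_trans li)//|rewrite (leq_trans lj)//]; rewrite leqNgt.
  - rewrite big_ord_recr/= ltnn.
    under eq_bigr do rewrite ltn_ord.
    have := ler_norm (f x - f y); rewrite distrC => H.
    have : e * (x - c) <= e * (y - c) by rewrite ler_pM2l// lerB.
    lra.
suff [_ [m [u [v [uv uvU triv fd]]]]] : P d.
  have : \sum_(i < m) `|f (v i) - f (u i)| < e.
    apply: acr => //; apply: (@sum_disjoint_itv_le _ _ _ U) => //.
    by move=> i; have [/andP[]] := uv i.
  lra.
have supP : has_sup P by split; [exists c|exists d => x [/andP[]]].
pose s := sup P.
have cs : c <= s by exact: sup_upper_bound.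
have sd : s <= d by apply: sup_le_ub; [exists c|move=> x [/andP[]]].
(* Around the supremum [s] the walk can pass from any point just below to any point just above.
   Hence [s] cannot be smaller than [d], and [d] itself is reached. *)
have [r' r'0 H] : exists2 r', 0 < r' &
    forall x y, P x -> s - r' < x -> x <= s -> s <= y -> y < s + r' -> y <= d -> P y.
  have [Ns|Ns] := pselect ((N `|` [set c; d]) s).
    have /nbhs_ballP[r' /= r'0 sU] : nbhs s U.
      by apply: open_nbhs_nbhs; split => //; exact: NU.
    exists r' => // x y Px xs xs' sy ys yd.
    apply: (extend2 x) => //; first exact: le_trans sy.
    by move=> z; rewrite /= in_itv/= => zxy; apply: sU; rewrite /ball/= ltr_norml; lra.
  have [l dl l0] : exists2 l, is_derive (s : R) 1 f l & 0 <= l.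
    apply: contrapT => /= nd; apply: Ns.
    have [->|sc] := eqVneq s c; first by right; left.
    have [->|sd'] := eqVneq s d; first by right; right.
    left; apply: subN => /= h; apply: nd; apply: h.
    by rewrite !lt_neqAle eq_sym sc cs sd' sd.
  have [r' r'0 H] := is_derive_lower dl l0 e0.
  exists r' => // x y Px xs xs' sy ys yd.
  by apply: (extend1 x) => //; [exact: le_trans sy|exact: H].
have [x Px sx] := sup_adherent r'0 supP.
have xs : x <= s by exact: sup_upper_bound.
have [sd'|ds] := ltP s d; last first.
  by apply: (H x) => //; rewrite (le_lt_trans ds)// ltrDl.
exfalso.
pose y := Num.min d (s + r' / 2).
have ys : s < y by rewrite /y lt_min sd' ltrDl divr_gt0.
suff /(sup_upper_bound supP) : P y by rewrite leNgt ys.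
apply: (H x) => //; rewrite ?ge_min ?lexx//; first exact: ltW.
by rewrite /y gt_min; apply/orP; right; lra.
Qed.
End Monotone.

(** * Lipschitz and absolutely continuous functions on a compact interval *)

Section Lipschitz.
Variable R : realType.
Implicit Types (c d : R) (f g : R -> R).

(** The solutions constructed below are Lipschitz on compact intervals. This class is closed under
    sums and products, so the minors of a solution belong to it and are absolutely continuous. *)
Definition lipschitz_itv c d f := exists2 L, 0 <= L &
  forall u v, c <= u -> u <= v -> v <= d -> `|f v - f u| <= L * (v - u).

Lemma lipschitz_itvS c d c' d' f : c <= c' -> d' <= d ->
  lipschitz_itv c d f -> lipschitz_itv c' d' f.
Proof.
move=> cc dd [L L0 H]; exists L => // u v cu uv vd.
by apply: H => //; [exact: le_trans cu|exact: le_trans dd].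
Qed.

Lemma lipschitz_itv_bounded c d f : lipschitz_itv c d f ->
  exists2 B, 0 <= B & forall t, c <= t <= d -> `|f t| <= B.
Proof.
move=> [L L0 H]; exists (`|f c| + L * `|d - c|).
  by rewrite addr_ge0// mulr_ge0.
move=> t /andP[ct td]; rewrite -[f t](subrK (f c)) addrC (le_trans (ler_normD _ _))//.
rewrite lerD2l (le_trans (H _ _ (lexx _) ct td))// ler_wpM2l//.
by rewrite (le_trans _ (ler_norm _))// lerB.
Qed.

Lemma lipschitz_itv_cst c d a : lipschitz_itv c d (fun=> a).
Proof. by exists 0 => // u v; rewrite subrr normr0 mul0r. Qed.

Lemma lipschitz_itvD c d f g : lipschitz_itv c d f -> lipschitz_itv c d g ->
  lipschitz_itv c d (fun t => f t + g t).
Proof.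
move=> [L L0 Hf] [M M0 Hg]; exists (L + M); first exact: addr_ge0.
move=> u v cu uv vd; rewrite mulrDl.
have -> : f v + g v - (f u + g u) = (f v - f u) + (g v - g u) by ring.
by rewrite (le_trans (ler_normD _ _))// lerD//; [exact: Hf|exact: Hg].
Qed.

Lemma lipschitz_itvM c d f g : lipschitz_itv c d f -> lipschitz_itv c d g ->
  lipschitz_itv c d (fun t => f t * g t).
Proof.
move=> lf lg.
have [B B0 Bf] := lipschitz_itv_bounded lf.
have [B' B'0 Bg] := lipschitz_itv_bounded lg.
case: lf lg => [L L0 Hf] [M M0 Hg]; exists (B' * L + B * M).
  by rewrite addr_ge0// mulr_ge0.
move=> u v cu uv vd.
have -> : f v * g v - f u * g u = g v * (f v - f u) + f u * (g v - g u) by ring.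
rewrite (le_trans (ler_normD _ _))// mulrDl !normrM -!mulrA lerD//.
  apply: ler_pM => //; last exact: Hf.
  by apply: Bg; rewrite vd (le_trans cu uv).
apply: ler_pM => //; last exact: Hg.
by apply: Bf; rewrite cu (le_trans uv vd).
Qed.

Lemma lipschitz_itv_sum (I : Type) (r : seq I) (P : pred I) (F : I -> R -> R) c d :
  (forall i, lipschitz_itv c d (F i)) ->
  lipschitz_itv c d (fun t => \sum_(i <- r | P i) F i t).
Proof.
move=> HF; elim: r => [|i r IH].
  rewrite (_ : (fun=> _) = fun=> 0); first exact: lipschitz_itv_cst.
  by apply/funext => t; rewrite big_nil.
have [Pi|nPi] := boolP (P i).
  rewrite (_ : (fun=> _) = fun t => F i t + \sum_(i <- r | P i) F i t).
    exact: lipschitz_itvD.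
  by apply/funext => t; rewrite big_cons Pi.
rewrite (_ : (fun=> _) = fun t => \sum_(i <- r | P i) F i t)//.
by apply/funext => t; rewrite big_cons (negbTE nPi).
Qed.

Lemma lipschitz_itv_prod (I : Type) (r : seq I) (P : pred I) (F : I -> R -> R) c d :
  (forall i, lipschitz_itv c d (F i)) ->
  lipschitz_itv c d (fun t => \prod_(i <- r | P i) F i t).
Proof.
move=> HF; elim: r => [|i r IH].
  rewrite (_ : (fun=> _) = fun=> 1); first exact: lipschitz_itv_cst.
  by apply/funext => t; rewrite big_nil.
have [Pi|nPi] := boolP (P i).
  rewrite (_ : (fun=> _) = fun t => F i t * \prod_(i <- r | P i) F i t).
    exact: lipschitz_itvM.
  by apply/funext => t; rewrite big_cons Pi.
rewrite (_ : (fun=> _) = fun t => \prod_(i <- r | P i) F i t)//.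
by apply/funext => t; rewrite big_cons (negbTE nPi).
Qed.

Lemma lipschitz_itv_derive c d f (f' : R -> R) B :
  (forall t, is_derive (t : R) 1 f (f' t)) ->
  (forall t, c <= t <= d -> `|f' t| <= B) -> lipschitz_itv c d f.
Proof.
move=> df f'B; exists `|B| => // u v cu uv vd.
have [|x xuv ->] := MVT_segment uv (fun t _ => df t).
  apply: continuous_subspaceT => t.
  by apply: differentiable_continuous; apply/derivable1_diffP; apply: ex_derive.
rewrite normrM [`|v - u|]ger0_norm ?subr_ge0// ler_wpM2r ?subr_ge0//.
rewrite (le_trans _ (ler_norm _))// f'B//.
move: xuv; rewrite in_itv/= => /andP[ux xv].
by rewrite (le_trans cu ux) (le_trans xv vd).
Qed.

Lemma lipschitz_ac c d f : lipschitz_itv c d f -> absolutely_continuous c d f.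
Proof.
(* [L + 1] because [L] may be zero. *)
move=> [L L0 H] e e0; exists (e / (L + 1)); first by rewrite divr_gt0// ltr_wpDl.
move=> m u v uv _; rewrite ltr_pdivlMr ?ltr_wpDl// => S.
apply: le_lt_trans S; rewrite mulrDr mulr1 mulr_suml -big_split/=.
apply: ler_sum => i _; have [/andP[cu uv'] vd] := uv i.
by rewrite (le_trans (H _ _ cu uv' vd))// mulrC lerDl subr_ge0.
Qed.

Lemma acD c d f g : absolutely_continuous c d f -> absolutely_continuous c d g ->
  absolutely_continuous c d (fun t => f t + g t).
Proof.
move=> acf acg e e0; have e2 : 0 < e / 2 by rewrite divr_gt0.
have [r r0 Hf] := acf _ e2; have [r' r'0 Hg] := acg _ e2.
exists (Num.min r r'); first by rewrite lt_min r0.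
move=> m u v uv triv; rewrite lt_min => /andP[ur ur'].
rewrite [e]splitr (le_lt_trans _ (ltrD (Hf m u v uv triv ur) (Hg m u v uv triv ur')))//.
rewrite -big_split/=; apply: ler_sum => i _.
have -> : f (v i) + g (v i) - (f (u i) + g (u i)) =
  (f (v i) - f (u i)) + (g (v i) - g (u i)) by ring.
exact: ler_normD.
Qed.

Lemma acN c d f : absolutely_continuous c d f ->
  absolutely_continuous c d (fun t => - f t).
Proof.
move=> acf e e0; have [r r0 H] := acf _ e0; exists r => // m u v uv triv ur.
rewrite (le_lt_trans _ (H m u v uv triv ur))//.
by apply: ler_sum => i _; rewrite -opprD normrN.
Qed.

Lemma acS c d c' d' f : c <= c' -> d' <= d ->
  absolutely_continuous c d f -> absolutely_continuous c' d' f.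
Proof.
move=> cc dd acf e e0; have [r r0 H] := acf _ e0; exists r => // m u v uv.
apply: H => i; have [/andP[cu ->] vd] := uv i.
by rewrite (le_trans cc cu) (le_trans vd dd).
Qed.

(** For [e = 1], the function changes by less than 1 over any step shorter than [r], and finitely
    many steps of length [r / 2] reach [d]. This serves uniqueness, where a competing solution is
    only absolutely continuous. *)
Lemma ac_bounded c d f : absolutely_continuous c d f ->
  exists2 B, 0 <= B & forall t, c <= t <= d -> `|f t| <= B.
Proof.
move=> /(_ 1 ltr01)[r r0 H].
have H1 x y : c <= x -> x <= y -> y <= d -> y < x + r -> `|f y - f x| < 1.
  move=> cx xy yd yx.
  have := H 1 (fun=> x) (fun=> y); rewrite !big_ord1; apply.
  - by move=> _; rewrite cx xy.
  - by move=> i j _ _ _; rewrite !ord1.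
  - by rewrite ltrBlDr addrC.
have Hk (k : nat) t : c <= t <= d -> t <= c + k%:R * (r / 2) -> `|f t - f c| <= k%:R.
  elim: k t => [|k IH] t /andP[ct td] tk.
    by move: tk; rewrite mul0r addr0 => tc; rewrite (@le_anti _ _ t c) ?tc// subrr normr0.
  have [tk'|kt] := leP t (c + k%:R * (r / 2)).
    by rewrite (le_trans (IH t _ tk'))// ?ct// ler_nat.
  set s := c + k%:R * (r / 2) in kt.
  have cs : c <= s by rewrite /s lerDl mulr_ge0// divr_ge0// ltW.
  have -> : f t - f c = (f s - f c) + (f t - f s) by ring.
  rewrite (le_trans (ler_normD _ _))// -natr1 lerD//.
    by rewrite IH// cs (le_trans (ltW kt) td).
  apply/ltW/H1 => //; first exact: ltW.
  by move: tk; rewrite -natr1 /s mulrDl mul1r; lra.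
have [k dk] : exists k : nat, d - c <= k%:R * (r / 2).
  exists (Num.bound `|(d - c) / (r / 2)|); rewrite -ler_pdivrMr ?divr_gt0//.
  exact: le_trans (ler_norm _) (ltW (archi_boundP (normr_ge0 _))).
exists (`|f c| + k%:R); first by rewrite addr_ge0.
move=> t /andP[ct td]; have -> : f t = f c + (f t - f c) by ring.
rewrite (le_trans (ler_normD _ _))// lerD2l Hk ?ct ?td//; lra.
Qed.

End Lipschitz.

(** * Differential inequalities holding almost everywhere *)

Section Comparison.
Variable R : realType.
Local Notation mu := (@lebesgue_measure R).
Implicit Types (c d t : R) (f : R -> R).

Lemma ae_imply (P Q : R -> Prop) : (\forall t \ae mu, P t) ->
  (forall t, P t -> Q t) -> \forall t \ae mu, Q t.
Proof.
move=> aeP PQ; apply: filterS aeP => //.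
exact: (ae_filter_ringOfSetsType mu).
Qed.

Lemma ae_and (P Q : R -> Prop) : (\forall t \ae mu, P t) ->
  (\forall t \ae mu, Q t) -> \forall t \ae mu, P t /\ Q t.
Proof.
by apply: filterI; exact: (ae_filter_ringOfSetsType mu).
Qed.

Lemma is_derive_expRZ (S K t0 t : R) :
  is_derive t 1 (fun s => S * expR (K * (s - t0))) (S * K * expR (K * (t - t0))).
Proof.
have d1 : is_derive t 1 (fun s : R => K * (s - t0)) K.
  have -> : (fun s : R => K * (s - t0)) = K \*: (id - cst t0 : R -> R) by [].
  by apply: is_derive_eq; rewrite subr0 [_ *: _]mulr1.
have d2 := @is_derive1_comp R expR (fun s => K * (s - t0)) t _ _
  (is_derive_expR _) d1.
have -> : (fun s : R => S * expR (K * (s - t0))) =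
   S \*: (expR \o (fun s : R => K * (s - t0)) : R -> R) by [].
by apply: is_derive_eq; rewrite [_ *: _]mulrA mulrAC.
Qed.

Lemma lipschitz_expRZ c d (S K t0 : R) :
  lipschitz_itv c d (fun s => S * expR (K * (s - t0))).
Proof.
apply: (@lipschitz_itv_derive _ _ _ _ (fun s => S * K * expR (K * (s - t0)))
  (`|S * K| * expR (`|K| * (`|c| + `|d| + `|t0|)))).
  by move=> t; exact: is_derive_expRZ.
move=> t /andP[ct td]; rewrite normrM ler_wpM2l// gtr0_norm ?expR_gt0// ler_expR.
rewrite (le_trans (ler_norm _))// normrM ler_wpM2l//.
have := ler_norm d; have := ler_norm (- c); rewrite normrN => ? ?.
have := ler_norm t0; have := ler_norm (- t0); rewrite normrN => ? ?.
have := normr_ge0 c; have := normr_ge0 d => ? ?.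
by rewrite ler_norml; lra.
Qed.

Lemma ac_comparison c d f h (h' : R -> R) : c <= d ->
  absolutely_continuous c d f -> lipschitz_itv c d h ->
  (forall t, is_derive (t : R) 1 h (h' t)) ->
  (\forall t \ae mu, c < t < d -> exists2 l, is_derive (t : R) 1 f l & h' t <= l) ->
  h d - h c <= f d - f c.
Proof.
move=> cd acf liph dh aef.
have : f c - h c <= f d - h d.
  apply: (@ac_nondecreasing _ c d (f - h)) => //.
    by apply: acD => //; apply: acN; exact: lipschitz_ac.
  apply: (ae_imply aef) => t H /H[l dl hl]; exists (l - h' t); last by rewrite subr_ge0.
  exact: is_deriveB.
lra.
Qed.

(** The comparison function [- S * expR (K * (s - c))] has value [- S] at [c]; the slack [S] is
    dropped, so that hypothesis and conclusion have the same exponential shape and the bound can be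
    iterated. *)
Lemma ac_forward_bound c d (S K : R) f : c <= d -> 0 <= S ->
  absolutely_continuous c d f -> 0 <= f c ->
  (\forall t \ae mu, c < t < d -> exists2 l, is_derive (t : R) 1 f l &
     - (S * K * expR (K * (t - c))) <= l) ->
  - (S * expR (K * (d - c))) <= f d.
Proof.
move=> cd S0 acf fc aef.
have := @ac_comparison c d f (fun s => - S * expR (K * (s - c)))
  (fun t => - S * K * expR (K * (t - c))) cd acf
  (lipschitz_expRZ _ _ _ _ _) (is_derive_expRZ _ _ _).
have H : \forall t \ae mu, c < t < d -> exists2 l, is_derive (t : R) 1 f l &
     - S * K * expR (K * (t - c)) <= l.
  by apply: (ae_imply aef) => t H /H[l dl Hl]; exists l => //; rewrite !mulNr.
move=> /(_ H); rewrite subrr mulr0 expR0; lra.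
Qed.

Lemma ac_backward_bound c d (S K : R) f : c <= d -> 0 <= S ->
  absolutely_continuous c d f -> 0 <= f d ->
  (\forall t \ae mu, c < t < d -> exists2 l, is_derive (t : R) 1 f l &
     l <= S * K * expR (K * (d - t))) ->
  - (S * expR (K * (d - c))) <= f c.
Proof.
move=> cd S0 acf fc aef.
have := @ac_comparison c d (fun t => - f t) (fun s => S * expR (- K * (s - d)))
  (fun t => S * - K * expR (- K * (t - d))) cd (acN acf)
  (lipschitz_expRZ _ _ _ _ _) (is_derive_expRZ _ _ _).
have H : \forall t \ae mu, c < t < d ->
    exists2 l, is_derive (t : R) 1 (fun t => - f t) l &
     S * - K * expR (- K * (t - d)) <= l.
  apply: (ae_imply aef) => t H /H[l dl Hl]; exists (- l); first exact: is_deriveN.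
  by rewrite mulNr -mulrN opprB mulrN mulNr lerN2.
move=> /(_ H); rewrite subrr mulr0 expR0 mulNr -mulrN opprB; lra.
Qed.

(** One pass of a Picard estimate: passing from the derivative to the function removes the factor
    [K]. When [K] is twice the bound on the coefficients, the constant [S] is thereby halved. *)
Lemma ac_growth_bound c d t0 (S K : R) f : c <= t0 <= d -> 0 <= S ->
  absolutely_continuous c d f -> f t0 = 0 ->
  (\forall t \ae mu, c < t < d -> exists2 l, is_derive (t : R) 1 f l &
     `|l| <= S * K * expR (K * `|t - t0|)) ->
  forall t, c <= t <= d -> `|f t| <= S * expR (K * `|t - t0|).
Proof.
move=> /andP[ct0 t0d] S0.
wlog suff : f / absolutely_continuous c d f -> f t0 = 0 ->
  (\forall t \ae mu, c < t < d -> exists2 l, is_derive (t : R) 1 f l &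
     `|l| <= S * K * expR (K * `|t - t0|)) ->
  forall t, c <= t <= d -> - (S * expR (K * `|t - t0|)) <= f t.
  move=> H acf f0 aef t ctd; rewrite ler_norml; apply/andP; split; first exact: H.
  rewrite -lerN2.
  apply: (H (fun t => - f t)) => //; first exact: acN.
    by rewrite f0 oppr0.
  apply: (ae_imply aef) => s Hs /Hs[l dl lS]; exists (- l); last by rewrite normrN.
  exact: is_deriveN.
move=> acf f0 aef t /andP[ct td].
have [t0t|tt0] := leP t0 t.
  rewrite ger0_norm ?subr_ge0//.
  apply: ac_forward_bound => //; [exact: acS acf|by rewrite f0|].
  apply: (ae_imply aef) => s Hs /andP[t0s st].
  have [|l dl lS] := Hs; first by rewrite (le_lt_trans ct0 t0s) (lt_le_trans st td).
  exists l => //; move: lS; rewrite ler_norml => /andP[+ _].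
  by rewrite ger0_norm// subr_ge0 ltW.
rewrite ltr0_norm ?subr_lt0// opprB.
apply: ac_backward_bound => //; [exact: ltW|exact: acS acf|by rewrite f0|].
apply: (ae_imply aef) => s Hs /andP[ts st0].
have [|l dl lS] := Hs; first by rewrite (le_lt_trans ct ts) (lt_le_trans st0 t0d).
exists l => //; move: lS; rewrite ler_norml => /andP[_].
by rewrite ltr0_norm ?subr_lt0// opprB.
Qed.

Lemma le0_of_halving (x C : R) : (forall k : nat, x <= C / 2 ^+ k) -> x <= 0.
Proof.
move=> H; rewrite leNgt; apply/negP => x0.
pose k := Num.bound (`|C| / x).
have : `|C| / x < 2 ^+ k.
  apply: lt_trans (archi_boundP _) _; first by rewrite divr_ge0// ltW.
  by rewrite -natrX ltr_nat ltn_expl.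
rewrite ltr_pdivrMr// mulrC => CX.
have := H k; rewrite ler_pdivlMr ?exprn_gt0// leNgt => /negP; apply.
exact: le_lt_trans (ler_norm _) CX.
Qed.

(* The weight [expR (2 M |t - t0|)] turns the integral operator into a contraction
   of ratio 1/2 on the whole interval. *)
Lemma ac_linear_eq0 (I : Type) c d t0 (M S0 : R) (Y : I -> R -> R) :
  c <= t0 <= d -> 0 <= M -> 0 <= S0 ->
  (forall i, absolutely_continuous c d (Y i)) -> (forall i, Y i t0 = 0) ->
  (forall i t, c <= t <= d -> `|Y i t| <= S0) ->
  (\forall t \ae mu, c < t < d -> forall i, exists2 l, is_derive (t : R) 1 (Y i) l &
     forall s, (forall j, `|Y j t| <= s) -> `|l| <= M * s) ->
  forall i t, c <= t <= d -> Y i t = 0.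
Proof.
move=> ct0d M0 S00 acY Y0 YS aeY i t ctd.
have key k : forall i t, c <= t <= d ->
    `|Y i t| <= S0 / 2 ^+ k * expR (2 * M * `|t - t0|).
  elim: k => [|k IH] {}i {}t {}ctd.
    rewrite expr0 divr1 (le_trans (YS _ _ ctd))// ler_peMr// -expR0 ler_expR.
    by rewrite !mulr_ge0.
  apply: (ac_growth_bound ct0d) ctd => //; first by rewrite divr_ge0// exprn_ge0.
  apply: (ae_imply aeY) => s Hs csd; have [l dl Hl] := Hs csd i; exists l => //.
  have csd' : c <= s <= d by case/andP: csd => /ltW -> /ltW ->.
  have := Hl _ (fun j => IH j s csd'); congr (_ <= _).
  by rewrite exprS; field; rewrite expf_neq0//.
apply/normr0_eq0/le_anti; rewrite normr_ge0 andbT.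
apply: (@le0_of_halving _ (S0 * expR (2 * M * `|t - t0|))) => k.
by rewrite mulrAC; exact: key.
Qed.

(** The one-sided analogue of [ac_linear_eq0]. Nonnegative coefficients turn a common lower bound
    [- s] on the components into the lower bound [- (M * s)] on the derivatives, so the lower bound
    [- S0] is halved at each pass, up to the exponential weight. *)
Lemma ac_linear_ge0 (I : Type) c d (M S0 : R) (Y : I -> R -> R) :
  c <= d -> 0 <= M -> 0 <= S0 ->
  (forall i, absolutely_continuous c d (Y i)) -> (forall i, 0 <= Y i c) ->
  (forall i t, c <= t <= d -> - S0 <= Y i t) ->
  (\forall t \ae mu, c < t < d -> forall i, exists2 l, is_derive (t : R) 1 (Y i) l &
     forall s, 0 <= s -> (forall j, - s <= Y j t) -> - (M * s) <= l) ->
  forall i t, c <= t <= d -> 0 <= Y i t.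
Proof.
move=> cd M0 S00 acY Y0 YS aeY i t ctd.
have key k : forall i t, c <= t <= d -> - (S0 / 2 ^+ k * expR (2 * M * (t - c))) <= Y i t.
  elim: k => [|k IH] {}i {}t {ctd} /andP[ct td].
    apply: le_trans (YS i t _); last by rewrite ct.
    rewrite expr0 divr1 lerN2 ler_peMr// -expR0 ler_expR.
    by rewrite !mulr_ge0// subr_ge0.
  apply: ac_forward_bound => //; first by rewrite divr_ge0// exprn_ge0.
    exact: acS (acY i).
  apply: (ae_imply aeY) => s Hs /andP[cs st].
  have [|l dl Hl] := Hs _ i; first by rewrite cs (lt_le_trans st).
  exists l => //.
  have csd' : c <= s <= d by rewrite (ltW cs) (le_trans (ltW st)).
  have := Hl _ _ (fun j => IH j s csd').
  rewrite mulr_ge0 ?expR_ge0 ?divr_ge0 ?exprn_ge0//.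
  move=> /(_ isT); congr (- _ <= _).
  by rewrite exprS; field; rewrite expf_neq0//.
rewrite -oppr_le0; apply: (@le0_of_halving _ (S0 * expR (2 * M * (t - c)))) => k.
by rewrite mulrAC lerNl; exact: key.
Qed.

End Comparison.

(** * Existence and uniqueness for linear systems *)

Section Primitive.
Variable R : realType.
Local Notation mu := (@lebesgue_measure R).

(** The properties of the integral of [f] from [t0] on which the iteration relies; the integral
    itself appears only in the proof that such an [F] exists. *)
Definition is_primitive (t0 : R) (f F : R -> R) :=
  [/\ F t0 = 0,
      forall u v M, u <= v -> (forall t, u < t < v -> `|f t| <= M) ->
        `|F v - F u| <= M * (v - u) &
      \forall t \ae mu, is_derive (t : R) 1 F (f t)].

Lemma exists_primitive (c d M t0 : R) (f : R -> R) :
  measurable_fun setT f -> (forall t, `|f t| <= M) ->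
  (forall t, ~ (c <= t <= d) -> f t = 0) -> exists F, is_primitive t0 f F.
Proof.
move=> mf fM f0.
have fE : f = f \_ `[c, d].
  apply/funext => t; rewrite patchE; case: ifPn => // /negP tcd.
  by apply: f0 => ctd; apply: tcd; rewrite inE/= in_itv.
have intcd : mu.-integrable `[c, d] (EFin \o f).
  apply: measurable_bounded_integrable => //.
  - rewrite /= lebesgue_measure_itv/=; case: ifP => // _.
    by rewrite -EFinB ltry.
  - exact: measurable_funS mf.
  - exists M; split; first exact: num_real.
    by move=> x Mx t _ /=; rewrite (le_trans (fM t))// ltW.
have intf : mu.-integrable setT (EFin \o f).
  by move: intcd; rewrite integrable_mkcond//= restrict_EFin -fE.
have intD (D : set R) : measurable D -> mu.-integrable D (EFin \o f).
  by move=> mD; apply: integrableS intf.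
have locf : locally_integrable setT f.
  by rewrite fE; apply: integrable_locally.
(* Integrating from [-oo] treats both sides of [t0] alike; [F t0] is subtracted afterwards. *)
pose F (x : R) := \int[mu]_(t in `]-oo, x]) f t.
have Fuv u v : u <= v -> F v - F u = \int[mu]_(t in `]u, v]) f t.
  by move=> uv; rewrite /F Rintegral_itvB//; apply: intD; exact: measurable_itv.
exists (fun t => F t - F t0); split; first by rewrite subrr.
- move=> u v B uv fB.
  have -> : F v - F t0 - (F u - F t0) = F v - F u by ring.
  have muv : lebesgue_measure `]u, v[%classic = (v - u)%:E.
    rewrite lebesgue_measure_itv/= lte_fin EFinB; case: ltP => // vu.
    by rewrite (@le_anti _ _ u v) ?uv// subee.
  (* Dropping the endpoint [v] leaves the open interval, where the bound on [f] is assumed. *)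
  rewrite Fuv// -Rintegral_itv_bndo_bndc; last by apply: intD; exact: measurable_itv.
  have int1 : mu.-integrable `]u, v[ (EFin \o f) by apply: intD; exact: measurable_itv.
  rewrite (le_trans (le_normr_Rintegral _ int1))//.
  rewrite (@le_trans _ _ (\int[mu]_(t in `]u, v[) B))//; last first.
    by rewrite Rintegral_cst//= [X in fine X]muv.
  apply: le_Rintegral => //.
  - exact: integrable_norm.
  - apply: measurable_bounded_integrable => //.
    + by rewrite [X in (X < _)%E]muv ltry.
    + exists `|B|; split; first exact: num_real.
      by move=> x Mx t _ /=; exact: ltW.
- have aeF := @FTC1Ny R f (fun y => intD _ (measurable_itv _)) locf.
  apply: (ae_imply aeF) => t [dF Ft].
  have dFt : is_derive t 1 F (f t).
    by rewrite -Ft derive1E; exact: derivableP.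
  change (is_derive t 1 (F - cst (F t0)) (f t)).
  by apply: is_derive_eq; rewrite subr0.
Qed.

(** Nested intervals: the tail of the geometric series from [k] on is [2 * C / 2 ^+ k], so every
    lower end [x j - 2 * C / 2 ^+ j] lies below every upper end, and the supremum of the lower ends
    is the limit. *)
Lemma geometric_limit_cst (x : nat -> R) (C : R) :
  (forall k, `|x k.+1 - x k| <= C / 2 ^+ k) ->
  exists l, forall k, `|l - x k| <= 2 * C / 2 ^+ k.
Proof.
move=> H.
have C0 : 0 <= C by have := le_trans (normr_ge0 _) (H 0%N); rewrite expr0 divr1.
have Hm k m : `|x (k + m)%N - x k| <= 2 * C / 2 ^+ k - 2 * C / 2 ^+ (k + m)%N.
  elim: m => [|m IH]; first by rewrite addn0 !subrr normr0.
  rewrite addnS.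
  have -> : x (k + m).+1 - x k =
      (x (k + m).+1 - x (k + m)%N) + (x (k + m)%N - x k) by ring.
  rewrite (le_trans (ler_normD _ _))// (le_trans (lerD (H _) IH))//.
  have -> : 2 * C / 2 ^+ (k + m).+1 = C / 2 ^+ (k + m).
    by rewrite exprS; field; rewrite expf_neq0.
  by lra.
have Hjk j k : x j - 2 * C / 2 ^+ j <= x k + 2 * C / 2 ^+ k.
  have pos i : 0 <= 2 * C / 2 ^+ i by rewrite divr_ge0 ?mulr_ge0 ?exprn_ge0.
  have [jk|kj] := leqP j k.
    have := Hm j (k - j)%N; rewrite subnKC// ler_norml => /andP[+ _].
    have := pos k; have := pos j; lra.
  have := Hm k (j - k)%N; rewrite subnKC 1?ltnW// ler_norml => /andP[_].
  have := pos k; have := pos j; lra.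
pose E := range (fun j => x j - 2 * C / 2 ^+ j).
have E0 : E !=set0 by exists (x 0%N - 2 * C / 2 ^+ 0); exists 0%N.
exists (sup E) => k.
have : x k - 2 * C / 2 ^+ k <= sup E.
  apply: sup_upper_bound; last by exists k.
  by split => //; exists (x 0%N + 2 * C / 2 ^+ 0) => _ [j _ <-]; exact: Hjk.
have : sup E <= x k + 2 * C / 2 ^+ k.
  by apply: sup_le_ub => // _ [j _ <-]; exact: Hjk.
rewrite ler_norml; lra.
Qed.

Lemma mulmx_entry_bound n (A W : 'M[R]_n) (M w : R) i j :
  (forall i j, `|A i j| <= M) -> (forall i j, `|W i j| <= w) ->
  `|(A *m W) i j| <= n%:R * M * w.
Proof.
move=> AM Ww; rewrite mxE (le_trans (ler_norm_sum _ _ _))//.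
rewrite (@le_trans _ _ (\sum_(l < n) M * w))//; last first.
  by rewrite sumr_const card_ord -mulrA mulr_natl.
by apply: ler_sum => l _; rewrite normrM ler_pM.
Qed.

End Primitive.

(** * Picard iteration for bounded Borel coefficients *)

Section Picard.
Variable R : realType.
Local Notation mu := (@lebesgue_measure R).

(** The limit is chosen before [C]: the limit at a given time can then be estimated with the
    constant of any window around [t0] containing that time. *)
Lemma geometric_limit (x : nat -> R) :
  (exists C, forall k, `|x k.+1 - x k| <= C / 2 ^+ k) ->
  exists l, forall C, (forall k, `|x k.+1 - x k| <= C / 2 ^+ k) ->
    forall k, `|l - x k| <= 2 * C / 2 ^+ k.
Proof.
move=> [C0 H0]; have [l Hl] := geometric_limit_cst H0; exists l => C H k.
have [l' Hl'] := geometric_limit_cst H.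
suff -> : l = l' by exact: Hl'.
apply/eqP; rewrite -subr_eq0 -normr_eq0 eq_le normr_ge0 andbT.
apply: (@le0_of_halving _ _ (2 * C0 + 2 * C)) => j.
have -> : l - l' = (l - x j) - (l' - x j) by ring.
by rewrite mulrDl (le_trans (ler_normB _ _))// lerD.
Qed.

Lemma ae_forall (I : finType) (P : I -> R -> Prop) :
  (forall i, \forall t \ae mu, P i t) -> \forall t \ae mu, forall i, P i t.
Proof.
by move=> H; apply: filter_forall => //; exact: (ae_filter_ringOfSetsType mu).
Qed.

Lemma measurable_fun_bigsum (I : Type) (r : seq I) (F : I -> R -> R) :
  (forall i, measurable_fun setT (F i)) ->
  measurable_fun setT (fun t => \sum_(i <- r) F i t).
Proof.
move=> mF; elim: r => [|i r IH].
  by under eq_fun do rewrite big_nil; exact: measurable_cst.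
by under eq_fun do rewrite big_cons; exact: measurable_funD.
Qed.

Variables (n : nat) (c d t0 M : R) (A : R -> 'M[R]_n).
Hypotheses (mA : forall i j, measurable_fun setT (fun t => A t i j))
  (AM : forall t i j, `|A t i j| <= M) (A0 : forall t, ~ (c <= t <= d) -> A t = 0)
  (M0 : 0 <= M).

(** A global Lipschitz bound is preserved by the iteration because [A] vanishes outside [[c, d]]; it
    keeps the iterates measurable and bounded on compact intervals. *)
Let lip (W : R -> 'M[R]_n) := exists2 L, 0 <= L &
  forall i j u v, u <= v -> `|W v i j - W u i j| <= L * (v - u).

(** The Picard operator, identity plus primitive of [A W]. For [W] satisfying [lip] a primitive
    exists by [T_primitive], so the default [fun=> 0] is not reached. *)
Let T (W : R -> 'M[R]_n) (t : R) : 'M[R]_n := \matrix_(i, j) ((1%:M : 'M[R]_n) i j +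
  xget (fun=> 0) [set F | is_primitive t0 (fun s => (A s *m W s) i j) F] t).

Let lip_itv W i j c' d' : lip W -> lipschitz_itv c' d' (fun t => W t i j).
Proof. by move=> [L L0 H]; exists L => // u v _ uv _; exact: H. Qed.

Let lip_measurable W i j : lip W -> measurable_fun setT (fun t => W t i j).
Proof.
move=> [L L0 H]; apply: continuous_measurable_fun => t.
apply/cvgrPdist_lt => e e0; near=> s.
have key u v : `|u - v| < e / (L + 1) -> `|W v i j - W u i j| < e.
  wlog uv : u v / u <= v.
    move=> h; have [uv|/ltW vu] := leP u v; first exact: h.
    by rewrite distrC [`|W _ _ _ - _|]distrC; exact: h.
  rewrite ltr_pdivlMr ?ltr_wpDl// distrC ger0_norm ?subr_ge0// => uve.
  rewrite (le_lt_trans (H i j u v uv))//.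
  by apply: le_lt_trans uve; rewrite mulrC ler_wpM2l ?subr_ge0// lerDl.
apply: key; rewrite distrC; near: s.
apply: (@cvgr_dist_lt _ _ _ (nbhs t) _ id) => //.
by rewrite divr_gt0// ltr_wpDl.
Unshelve. all: by end_near. Qed.

Let lip_bounded W c' d' : lip W ->
  exists2 w, 0 <= w & forall t i j, c' <= t <= d' -> `|W t i j| <= w.
Proof.
move=> lW; have H i j := lipschitz_itv_bounded (@lip_itv W i j c' d' lW).
exists (\sum_i \sum_j sval (cid2 (H i j))).
  by apply: sumr_ge0 => i _; apply: sumr_ge0 => j _; case: cid2.
move=> t i j tcd.
rewrite (bigD1 i)//= (bigD1 j)//= -addrA.
case: cid2 => /= B B0 HB; rewrite (le_trans (HB t tcd))// lerDl addr_ge0//.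
  by apply: sumr_ge0 => l _; case: cid2.
by apply: sumr_ge0 => k _; apply: sumr_ge0 => l _; case: cid2.
Qed.

Let AW_bound (W : R -> 'M[R]_n) w s i j : 0 <= w ->
  (forall i j, c <= s <= d -> `|W s i j| <= w) ->
  `|(A s *m W s) i j| <= n%:R * M * w.
Proof.
move=> w0 Ww.
have [scd|scd] := pselect (c <= s <= d).
  by apply: mulmx_entry_bound => // k l; exact: Ww.
by rewrite (A0 scd) mul0mx mxE normr0 !mulr_ge0.
Qed.

Let T_primitive W i j : lip W ->
  is_primitive t0 (fun s => (A s *m W s) i j) (fun t => T W t i j - (1%:M : 'M[R]_n) i j).
Proof.
move=> lW.
have [w w0 Ww] := lip_bounded c d lW.
have [F HF] : exists F, is_primitive t0 (fun s => (A s *m W s) i j) F.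
  apply: (@exists_primitive _ c d (n%:R * M * w)).
  - rewrite (_ : (fun _ => _) = fun s => \sum_l (A s i l * W s l j)).
      apply: measurable_fun_bigsum => l; apply: measurable_funM => //.
      exact: lip_measurable.
    by apply/funext => s; rewrite mxE.
  - by move=> t; apply: AW_bound => // k l; exact: Ww.
  - by move=> t tcd; rewrite (A0 tcd) mul0mx mxE.
rewrite (_ : (fun t => T W t i j - _) =
  xget (fun=> 0) [set F | is_primitive t0 (fun s => (A s *m W s) i j) F]).
  exact: (xgetPex (fun=> 0) (ex_intro _ F HF)).
by apply/funext => t; rewrite mxE addrAC subrr add0r.
Qed.

Let T_t0 W : lip W -> T W t0 = 1%:M.
Proof.
move=> lW; apply/matrixP => i j; have [/eqP] := T_primitive i j lW.
by rewrite subr_eq0 => /eqP.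
Qed.

Let T_lip_cst W w : lip W -> 0 <= w ->
  (forall t i j, c <= t <= d -> `|W t i j| <= w) ->
  forall i j u v, u <= v -> `|T W v i j - T W u i j| <= n%:R * M * w * (v - u).
Proof.
move=> lW w0 Ww i j u v uv; have [_ H _] := T_primitive i j lW.
have := H u v (n%:R * M * w) uv (fun s _ => AW_bound i j w0 (fun i j => Ww s i j)).
by congr (`|_| <= _); ring.
Qed.

Let T_lip W : lip W -> lip (T W).
Proof.
move=> lW; have [w w0 Ww] := lip_bounded c d lW.
by exists (n%:R * M * w); [rewrite !mulr_ge0|exact: T_lip_cst].
Qed.

Let T_derive W : lip W -> \forall t \ae mu, forall i j,
  is_derive (t : R) 1 (fun s => T W s i j) ((A t *m W t) i j).
Proof.
move=> lW; apply: ae_forall => i; apply: ae_forall => j.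
have [_ _ H] := T_primitive i j lW; apply: (ae_imply H) => t dt.
have -> : (fun s => T W s i j) =
    (fun s => T W s i j - (1%:M : 'M[R]_n) i j) + cst ((1%:M : 'M[R]_n) i j).
  by apply/funext => s /=; rewrite fctE /= subrK.
by apply: is_derive_eq; rewrite addr0.
Qed.

(** Twice the bound [n * M] on multiplication by [A] in the entrywise maximum norm, which makes the
    contraction ratio 1/2. *)
Let K := 2 * (n%:R * M).

Let T_contract W W' S c' d' : lip W -> lip W' -> 0 <= S -> c' <= t0 <= d' ->
  (forall t i j, c' <= t <= d' -> `|W t i j - W' t i j| <= S * expR (K * `|t - t0|)) ->
  forall t i j, c' <= t <= d' ->
    `|T W t i j - T W' t i j| <= S / 2 * expR (K * `|t - t0|).
Proof.
move=> lW lW' S0 ct0d HS t i j ctd.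
apply: (@ac_growth_bound _ c' d' t0 _ _ (fun t => T W t i j - T W' t i j)) => //.
- by rewrite divr_ge0.
- apply: acD; first exact/lipschitz_ac/lip_itv/T_lip.
  by apply: acN; exact/lipschitz_ac/lip_itv/T_lip.
- by rewrite !T_t0// subrr.
apply: (ae_imply (ae_and (T_derive lW) (T_derive lW'))) => s [dW dW'] csd.
exists ((A s *m (W s - W' s)) i j).
  rewrite mulmxBr mxE [X in _ + X]mxE; exact: is_deriveB.
have -> : S / 2 * K * expR (K * `|s - t0|) = n%:R * M * (S * expR (K * `|s - t0|)).
  by rewrite /K; field.
apply: mulmx_entry_bound => // k l; rewrite !mxE; apply: HS.
by case/andP: csd => /ltW -> /ltW ->.
Qed.

Let X k := iter k T (fun=> 1%:M).

Let X_lip k : lip (X k).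
Proof.
elim: k => [|k IH]; last exact: T_lip.
by exists 0 => // i j u v _; rewrite subrr normr0 mul0r.
Qed.

(** The window is centred at [t0], which may lie outside [[c, d]]; [S] depends on [r] but not on
    [k]. *)
Let X_step r : 0 <= r -> exists2 S, 0 <= S & forall k t i j, t0 - r <= t <= t0 + r ->
  `|X k.+1 t i j - X k t i j| <= S * expR (K * `|t - t0|) / 2 ^+ k.
Proof.
move=> r0.
have [w w0 Ww] := lip_bounded (t0 - r) (t0 + r) (X_lip 1).
have [w' w'0 Ww'] := lip_bounded (t0 - r) (t0 + r) (X_lip 0).
exists (w + w'); first exact: addr_ge0.
have E t : 1 <= expR (K * `|t - t0|) by rewrite -expR0 ler_expR !mulr_ge0.
elim=> [|k IH] t i j tr.
  rewrite expr0 divr1 (le_trans (ler_normB _ _))//.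
  by rewrite (le_trans (lerD (Ww _ _ _ tr) (Ww' _ _ _ tr)))// ler_peMr ?addr_ge0.
have := @T_contract (X k.+1) (X k) ((w + w') / 2 ^+ k) (t0 - r) (t0 + r)
  (X_lip _) (X_lip _).
rewrite divr_ge0 ?addr_ge0 ?exprn_ge0// => /(_ isT).
rewrite lerBlDr lerDl r0 => /(_ isT) H.
have -> : (w + w') * expR (K * `|t - t0|) / 2 ^+ k.+1 =
    (w + w') / 2 ^+ k / 2 * expR (K * `|t - t0|).
  by rewrite exprS; field; rewrite expf_neq0.
by apply: H => // s k' l sr; rewrite mulrAC; exact: IH.
Qed.

Lemma bounded_linear_ode_exists : exists X : R -> 'M[R]_n, [/\ X t0 = 1%:M,
  forall i j c' d', lipschitz_itv c' d' (fun t => X t i j) &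
  \forall t \ae mu, forall i j,
    is_derive (t : R) 1 (fun s => X s i j) ((A t *m X t) i j)].
Proof.
have cauchyX t i j : exists l, forall C,
    (forall k, `|X k.+1 t i j - X k t i j| <= C / 2 ^+ k) ->
    forall k, `|l - X k t i j| <= 2 * C / 2 ^+ k.
  apply: geometric_limit.
  have [S S0 HS] := X_step (normr_ge0 (t - t0)).
  exists (S * expR (K * `|t - t0|)) => k; apply: HS.
  by have := ler_norm (t - t0); have := ler_norm (t0 - t); rewrite distrC; lra.
pose Z t := \matrix_(i, j) sval (cid (cauchyX t i j)).
have ZX r : 0 <= r -> exists2 S, 0 <= S & forall k t i j, t0 - r <= t <= t0 + r ->
    `|Z t i j - X k t i j| <= 2 * S / 2 ^+ k * expR (K * `|t - t0|).
  move=> r0; have [S S0 HS] := X_step r0; exists S => // k t i j tr.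
  rewrite mxE; case: cid => l /= Hl.
  have := Hl _ (fun k => HS k t i j tr) k.
  by congr (_ <= _); ring.
(* The bound must be uniform in [k], so that [T_lip_cst] gives one Lipschitz constant for all
   iterates, which passes to [Z]. *)
have [w w0 Xw] : exists2 w, 0 <= w & forall k t i j, c <= t <= d -> `|X k t i j| <= w.
  pose r := `|c - t0| + `|d - t0|.
  have [S S0 HS] := ZX r (addr_ge0 (normr_ge0 _) (normr_ge0 _)).
  have [w w0 Hw] := lip_bounded c d (X_lip 0).
  (* The [4] comes from two distances to [Z], each at most [2 * S * expR (K * r)]. *)
  exists (w + 4 * S * expR (K * r)).
    by rewrite addr_ge0 ?mulr_ge0 ?expR_ge0.
  move=> k t i j tcd.
  have tr : `|t - t0| <= r.
    have := ler_norm (d - t0); have := ler_norm (t0 - c).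
    have := normr_ge0 (d - t0); have := normr_ge0 (c - t0).
    by rewrite (distrC t0 c) /r ler_norml; lra.
  have tr' : t0 - r <= t <= t0 + r by move: tr; rewrite ler_norml; lra.
  have HZ l : `|Z t i j - X l t i j| <= 2 * S * expR (K * r).
    rewrite (le_trans (HS _ _ _ _ tr'))//.
    apply: ler_pM; rewrite ?expR_ge0 ?divr_ge0 ?mulr_ge0 ?exprn_ge0//.
      by rewrite ler_pdivrMr ?exprn_gt0// ler_peMr ?mulr_ge0// exprn_ege1// ler1n.
    by rewrite ler_expR ler_wpM2l// !mulr_ge0.
  have -> : X k t i j = X 0 t i j + ((Z t i j - X 0 t i j) - (Z t i j - X k t i j)).
    by ring.
  rewrite (le_trans (ler_normD _ _))// lerD ?Hw// (le_trans (ler_normB _ _))//.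
  by have := HZ 0; have := HZ k; lra.
have lZ : lip Z.
  exists (n%:R * M * w); first by rewrite !mulr_ge0.
  move=> i j u v uv; rewrite -subr_le0.
  pose r := `|u - t0| + `|v - t0|.
  have [S S0 HS] := ZX r (addr_ge0 (normr_ge0 _) (normr_ge0 _)).
  have ur : t0 - r <= u <= t0 + r.
    have := ler_norm (u - t0); have := ler_norm (t0 - u); rewrite distrC.
    by have := normr_ge0 (v - t0); rewrite /r; lra.
  have vr : t0 - r <= v <= t0 + r.
    have := ler_norm (v - t0); have := ler_norm (t0 - v); rewrite distrC.
    by have := normr_ge0 (u - t0); rewrite /r; lra.
  apply: (@le0_of_halving _ _ (S * expR (K * `|u - t0|) + S * expR (K * `|v - t0|))) => k.
  have := T_lip_cst (X_lip k) w0 (Xw k) i j uv.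
  have := HS k.+1 _ i j ur; have := HS k.+1 _ i j vr.
  have E : 2 * S / 2 ^+ k.+1 = S / 2 ^+ k by rewrite exprS; field; rewrite expf_neq0.
  rewrite E; set x := X _ v i j; set y := X _ u i j => Hv Hu Hxy.
  have -> : Z v i j - Z u i j = (Z v i j - x) - (Z u i j - y) + (x - y) by ring.
  rewrite lerBlDr (le_trans (ler_normD _ _))// lerD//.
  rewrite (le_trans (ler_normB _ _))// addrC.
  by apply: le_trans (lerD Hu Hv) _; lra.
(* [T Z - Z] is [T Z - T (X k)] minus [Z - X k.+1], and both are at most [S / 2 ^+ k] times the
   weight, for every [k]. *)
have TZ : T Z = Z.
  apply/funext => t; apply/matrixP => i j; apply/eqP.
  rewrite -subr_eq0 -normr_eq0 eq_le normr_ge0 andbT.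
  have [S S0 HS] := ZX _ (normr_ge0 (t - t0)).
  have tr : t0 - `|t - t0| <= t <= t0 + `|t - t0|.
    by have := ler_norm (t - t0); have := ler_norm (t0 - t); rewrite distrC; lra.
  apply: (@le0_of_halving _ _ (2 * (S * expR (K * `|t - t0|)))) => k.
  have := @T_contract Z (X k) (2 * S / 2 ^+ k) (t0 - `|t - t0|) (t0 + `|t - t0|) lZ
    (X_lip k).
  rewrite divr_ge0 ?mulr_ge0 ?exprn_ge0// lerBlDr lerDl normr_ge0.
  move=> /(_ isT isT (HS k) t i j tr) H1.
  have H2 := HS k.+1 t i j tr.
  have E : 2 * S / 2 ^+ k.+1 = S / 2 ^+ k by rewrite exprS; field; rewrite expf_neq0.
  rewrite E in H2.
  have E' : 2 * S / 2 ^+ k / 2 = S / 2 ^+ k by field; rewrite expf_neq0.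
  rewrite E' in H1.
  rewrite (_ : T Z t i j - Z t i j =
    (T Z t i j - T (X k) t i j) - (Z t i j - X k.+1 t i j)); last first.
    by rewrite /X iterS; ring.
  rewrite (le_trans (ler_normB _ _))// (le_trans (lerD H1 H2))//.
  by lra.
exists Z; split.
- by rewrite -TZ T_t0.
- by move=> i j c' d'; exact: lip_itv.
- by have := T_derive lZ; rewrite TZ.
Qed.

End Picard.

(** * From Lebesgue measurable to Borel coefficients *)

Section BorelRepresentative.
Variable R : realType.
Local Notation mu := (@lebesgue_measure R).

(** Provides countably many levels for testing measurability, and countably many endpoints for
    exhausting [(a, b)] at the cost of a single null set. *)
Lemma exists_dense_seq : exists q : nat -> R, forall x y, x < y ->
  exists k, x < q k < y.
Proof.
exists (fun k => ratr (odflt 0 (unpickle k))) => x y xy.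
have [r] := rat_in_itvoo xy; rewrite in_itv/= => rxy.
by exists (pickle r); rewrite pickleK.
Qed.

Lemma completed_borel (S : set R) :
  (completed_algebra_gen mu).-sigma.-measurable S ->
  exists B N : set R, [/\ measurable B, measurable N, mu N = 0 &
    forall t, ~ N t -> S t <-> B t].
Proof.
rewrite g_sigma_completed_algebra_genE => -[/= B mB [N [N' [mN' N'0 NN']]] <-].
exists B, N'; split => // t N't; split; last by left.
by case => // /NN'.
Qed.

Lemma oitv_measurable (a b : \bar R) : measurable (oitv a b).
Proof.
have -> : oitv a b = EFin @^-1` (`]a, b[%classic : set (\bar R)).
  by apply/seteqP; split => t; rewrite /oitv /= in_itv.
have := @EFin_measurable R setT; rewrite /measurable_fun.
move=> /(_ measurableT `]a, b[%classic); rewrite setTI; apply.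
exact: emeasurable_itv.
Qed.

(** Each sublevel set of [f] at a level [q k] is Borel up to a null set. Removing these countably
    many null sets, and the one where the essential bound fails, leaves a Borel set [G], on which
    [f] is Borel and bounded; outside [G] it is set to zero. *)
Lemma borel_representative (a b : \bar R) (c d : R) (f : R -> R) :
  `[c, d] `<=` oitv a b -> lebesgue_measurable_fun (oitv a b) f ->
  locally_ess_bounded (oitv a b) f ->
  exists g : R -> R, [/\ measurable_fun setT g,
    exists2 M, 0 <= M & forall t, `|g t| <= M,
    forall t, ~ (c <= t <= d) -> g t = 0 &
    \forall t \ae mu, c <= t <= d -> f t = g t].
Proof.
move=> cdab mf bf.
have [q qdense] := exists_dense_seq.
have [M M0 [N0 [mN0 N00 fM]]] : exists2 M, 0 <= M &
    \forall t \ae mu, `|(f \_ `[c, d]) t| <= M.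
  have bM := bf _ (@segment_compact _ c d) cdab.
  have [M M0 HM] : exists2 M, 0 <= M &
      (ess_sup mu (fun t => `|(f \_ `[c, d]) t|%:E) <= M%:E)%E.
    case: (ess_sup _ _) bM => [r|//|] _.
      by exists `|r| => //; rewrite lee_fin ler_norm.
    by exists 0 => //; rewrite leNye.
  exists M => //; move/ess_supP : HM => HM.
  by apply: (ae_imply HM) => t; rewrite lee_fin.
have mS k : (completed_algebra_gen mu).-sigma.-measurable
    (oitv a b `&` f @^-1` `]-oo, q k[).
  apply: mf; last exact: measurable_itv.
  apply: sub_sigma_algebra; exists (oitv a b); first exact: oitv_measurable.
  by exists set0; [exact: negligible_set0|rewrite setU0].
have /choice[B] := fun k => completed_borel (mS k).
move=> /choice[N BN].
pose G := `[c, d] `\` (N0 `|` \bigcup_k N k).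
have mNN : measurable (\bigcup_k N k).
  by apply: bigcupT_measurable => k; have [] := BN k.
have mG : measurable G.
  by apply: measurableD; [exact: measurable_itv|exact: measurableU].
exists (f \_ G); split.
- apply/(measurable_restrictT _ mG).
  apply: (measurability _ (RGenInftyO.measurableE R)) => _ [_ [x ->] <-].
  rewrite (_ : G `&` _ = \bigcup_(k in [set k | q k < x]) (G `&` B k)).
    apply: bigcup_measurable => k _; apply: measurableI => //.
    by have [] := BN k.
  apply/seteqP; split => [t [Gt /=]|t [k /= qx [Gt Bt]]].
    rewrite in_itv/= => fx; have [k /andP[fq qx]] := qdense _ _ fx.
    exists k => //; split => //; have [_ _ _ H] := BN k.
    have [tcd tN] := Gt; apply/H.
      by move=> Nt; apply: tN; right; exists k.
    by split; [exact: cdab|rewrite /= in_itv].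
  split => //=; rewrite in_itv/=; apply: lt_trans qx.
  have [_ _ _ H] := BN k; have [tcd tN] := Gt.
  have [_] : (oitv a b `&` f @^-1` `]-oo, q k[) t.
    by apply/H => // Nt; apply: tN; right; exists k.
  by rewrite /= in_itv.
- exists M => // t; rewrite patchE; case: ifPn; last by rewrite normr0.
  rewrite inE => -[tcd tN]; apply: contrapT => ntM; apply: tN; left.
  by apply: fM => /=; rewrite patchE mem_set.
- move=> t ntcd; rewrite patchE; case: ifPn => //.
  by rewrite inE => -[]; rewrite /= in_itv.
- exists (N0 `|` \bigcup_k N k); split => /=.
  + exact: measurableU.
  + apply/eqP; rewrite eq_le measure_ge0 andbT.
    rewrite (le_trans (measureU2 _ _ _))// [X in (X + _)%E]N00 add0e.
    have : mu.-negligible (\bigcup_k N k).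
      by apply: negligible_bigcup => k; apply/negligibleP; have [] := BN k.
    by move=> /negligibleP => /(_ mNN) H; rewrite [X in (X <= _)%E]H.
  + move=> t /= nft; apply: contrapT => tN; apply: nft => tcd.
    by rewrite patchE mem_set//; split; rewrite //= in_itv.
Qed.

End BorelRepresentative.

(** * Uniqueness and the transition matrix *)

Section TransitionMatrix.
Variables (R : realType) (n : nat).
Local Notation mu := (@lebesgue_measure R).

(** A local solution carries a Lipschitz bound, stronger than absolute continuity, because the
    bounds on its minors are derived from it. *)
Definition solution_on (A : R -> 'M[R]_n) (c d t0 : R) (X : R -> 'M[R]_n) :=
  [/\ X t0 = 1%:M, forall i j, lipschitz_itv c d (fun t => X t i j) &
    \forall t \ae mu, c < t < d -> forall i j,
      is_derive (t : R) 1 (fun s => X s i j) ((A t *m X t) i j)].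

Lemma linear_ode_unique (A : R -> 'M[R]_n) (c d t0 M : R) (X Y : R -> 'M[R]_n) :
  c <= t0 <= d -> 0 <= M ->
  (\forall t \ae mu, c <= t <= d -> forall i j, `|A t i j| <= M) ->
  X t0 = Y t0 ->
  (forall i j, absolutely_continuous c d (fun t => X t i j)) ->
  (forall i j, absolutely_continuous c d (fun t => Y t i j)) ->
  (\forall t \ae mu, c < t < d -> forall i j,
      is_derive (t : R) 1 (fun s => X s i j) ((A t *m X t) i j)) ->
  (\forall t \ae mu, c < t < d -> forall i j,
      is_derive (t : R) 1 (fun s => Y s i j) ((A t *m Y t) i j)) ->
  forall t, c <= t <= d -> X t = Y t.
Proof.
move=> ct0d M0 AM XY acX acY dX dY t ctd; apply/matrixP => i j.
pose D (ij : 'I_n * 'I_n) s := X s ij.1 ij.2 - Y s ij.1 ij.2.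
have ac_D ij : absolutely_continuous c d (D ij) by apply: acD => //; exact: acN.
pose B ij := sval (cid2 (ac_bounded (ac_D ij))).
have B0 ij : 0 <= B ij by rewrite /B; case: cid2.
suff : D (i, j) t = 0 by move/eqP; rewrite subr_eq0 => /eqP.
apply: (@ac_linear_eq0 R _ c d t0 (n%:R * M) (\sum_ij B ij)) => //.
- by rewrite mulr_ge0.
- by rewrite sumr_ge0.
- by move=> ij; rewrite /D XY subrr.
- move=> ij s csd; rewrite (@le_trans _ _ (B ij))//.
    by rewrite /B; case: cid2 => b /= _; exact.
  by rewrite (bigD1 ij)//= lerDl sumr_ge0.
- apply: (ae_imply (ae_and AM (ae_and dX dY))) => s [As [Xs Ys]] csd [k l] /=.
  exists ((A s *m (X s - Y s)) k l).
    by rewrite mulmxBr mxE [X in _ + X]mxE; apply: is_deriveB; [exact: Xs|exact: Ys].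
  move=> w Dw; apply: mulmx_entry_bound.
    by apply: As; case/andP: csd => /ltW -> /ltW ->.
  by move=> k' l'; rewrite !mxE; exact: (Dw (k', l')).
Qed.

Variables (a b : \bar R) (A : R -> 'M[R]_n).
Hypotheses (Ameas : forall i j, lebesgue_measurable_fun (oitv a b) (fun t => A t i j))
  (Abnd : forall i j, locally_ess_bounded (oitv a b) (fun t => A t i j)).

Lemma coeff_borel_representative (c d : R) : `[c, d] `<=` oitv a b ->
  exists (A' : R -> 'M[R]_n) (M : R), [/\ 0 <= M,
    forall i j, measurable_fun setT (fun t => A' t i j),
    forall t i j, `|A' t i j| <= M, forall t, ~ (c <= t <= d) -> A' t = 0 &
    \forall t \ae mu, c <= t <= d -> A t = A' t].
Proof.
move=> cdab.
have H (ij : 'I_n * 'I_n) :=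
  borel_representative cdab (@Ameas ij.1 ij.2) (@Abnd ij.1 ij.2).
have [g Hg] := choice H.
have gM ij : exists2 M, 0 <= M & forall t, `|g ij t| <= M by have [] := Hg ij.
pose M ij := sval (cid2 (gM ij)).
have M0 ij : 0 <= M ij by rewrite /M; case: cid2.
exists (fun t => \matrix_(i, j) g (i, j) t), (\sum_ij M ij); split.
- exact: sumr_ge0.
- move=> i j; rewrite (_ : (fun _ => _) = g (i, j)); first by have [] := Hg (i, j).
  by apply/funext => t; rewrite mxE.
- move=> t i j; rewrite mxE (@le_trans _ _ (M (i, j)))//.
    by rewrite /M; case: cid2.
  by rewrite (bigD1 (i, j))//= lerDl sumr_ge0.
- move=> t tcd; apply/matrixP => i j; rewrite !mxE.
  by have [_ _ -> //] := Hg (i, j).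
- have aeg : \forall t \ae mu, forall ij, c <= t <= d -> A t ij.1 ij.2 = g ij t.
    by apply: ae_forall => ij; have [] := Hg ij.
  apply: (ae_imply aeg) => t Ht tcd; apply/matrixP => i j.
  by rewrite mxE (Ht (i, j)).
Qed.

Lemma coeff_ae_bounded (c d : R) : `[c, d] `<=` oitv a b ->
  exists2 M, 0 <= M &
    \forall t \ae mu, c <= t <= d -> forall i j, `|A t i j| <= M.
Proof.
move=> /coeff_borel_representative[A' [M [M0 _ A'M _ AA']]]; exists M => //.
by apply: (ae_imply AA') => t AA't tcd i j; rewrite AA't.
Qed.

Lemma solution_on_exists (c d t0 : R) : `[c, d] `<=` oitv a b ->
  exists X, solution_on A c d t0 X.
Proof.
move=> /coeff_borel_representative[A' [M [M0 mA' A'M A'0 AA']]].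
have [X [Xt0 lX dX]] := bounded_linear_ode_exists t0 mA' A'M A'0 M0.
exists X; split => //.
apply: (ae_imply (ae_and AA' dX)) => t [AA't dXt] ctd i j.
by rewrite AA't//; case/andP: ctd => /ltW -> /ltW ->.
Qed.

Lemma solution_on_unique (c d c' d' t0 : R) (X Y : R -> 'M[R]_n) :
  `[c, d] `<=` oitv a b -> c <= t0 <= d -> c' <= c -> d <= d' ->
  solution_on A c d t0 X -> solution_on A c' d' t0 Y ->
  forall t, c <= t <= d -> X t = Y t.
Proof.
move=> cdab ct0d cc dd [Xt0 lX dX] [Yt0 lY dY].
have [M M0 AM] := coeff_ae_bounded cdab.
apply: (linear_ode_unique ct0d M0 AM) => //; first by rewrite Xt0.
- by move=> i j; exact: lipschitz_ac.
- by move=> i j; apply/lipschitz_ac/(lipschitz_itvS cc dd).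
- apply: (ae_imply dY) => t H /andP[ct td]; apply: H.
  by rewrite (le_lt_trans cc ct) (lt_le_trans td dd).
Qed.

(** For each [t] a solution is chosen on the smallest interval containing [t] and [t0]. The choices
    are independent of each other; [fundamental_matrixE] shows by uniqueness that they agree with
    any solution on a larger interval. *)
Definition fundamental_matrix (t t0 : R) : 'M[R]_n :=
  xget (fun=> 0) [set X | solution_on A (Num.min t t0) (Num.max t t0) t0 X] t.

Lemma oitv_sub (c d : R) : oitv a b c -> oitv a b d -> `[c, d] `<=` oitv a b.
Proof.
move=> /andP[ac _] /andP[_ db] t; rewrite /= in_itv/= => /andP[ct td].
by apply/andP; split; [exact: lt_le_trans ac _|exact: le_lt_trans db].
Qed.

Lemma fundamental_matrixE (c d t0 : R) (X : R -> 'M[R]_n) :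
  `[c, d] `<=` oitv a b -> c <= t0 <= d -> solution_on A c d t0 X ->
  forall t, c <= t <= d -> X t = fundamental_matrix t t0.
Proof.
move=> cdab /andP[ct0 t0d] sX t /andP[ct td].
have sub : `[Num.min t t0, Num.max t t0] `<=` oitv a b.
  apply: subset_trans cdab => s; rewrite /= !in_itv/= ge_min le_max.
  case/andP => /orP[] h1 /orP[] h2; apply/andP; split;
    move: ct0 t0d ct td h1 h2; clear; lra.
have [Y sY] := solution_on_exists t0 sub.
have sZ := xgetPex (fun=> 0) (ex_intro _ Y sY).
apply/esym; apply: (solution_on_unique sub _ _ _ sZ sX) => //.
- by rewrite ge_min lexx orbT le_max lexx orbT.
- by rewrite le_min ct ct0.
- by rewrite ge_max td t0d.
- by rewrite ge_min lexx le_max lexx.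
Qed.

End TransitionMatrix.

Section TransitionMatrixSpec.
Variables (R : realType) (n : nat).
Local Notation mu := (@lebesgue_measure R).
Variables (a b : \bar R) (A : R -> 'M[R]_n).
Hypotheses (Ameas : forall i j, lebesgue_measurable_fun (oitv a b) (fun t => A t i j))
  (Abnd : forall i j, locally_ess_bounded (oitv a b) (fun t => A t i j)).

Lemma oitv_dense (q : nat -> R) (s : R) : oitv a b s ->
  (forall x y, x < y -> exists k, x < q k < y) ->
  exists k l, [/\ oitv a b (q k), oitv a b (q l), q k < s & s < q l].
Proof.
move=> /andP[sa sb] qdense.
have [c ac cs] : exists2 c : R, (a <= c%:E)%E & c < s.
  case: a sa => [r|//|] sa; first by exists r => //; rewrite -lte_fin.
  by exists (s - 1); rewrite ?leNye// ltrBlDr ltrDl.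
have [d db sd] : exists2 d : R, (d%:E <= b)%E & s < d.
  case: b sb => [r|//|//] sb; first by exists r => //; rewrite -lte_fin.
  by exists (s + 1); rewrite ?leey// ltrDl.
have [k /andP[ck ks]] := qdense _ _ cs; have [l /andP[sl ld]] := qdense _ _ sd.
exists k, l; split => //; apply/andP; split.
- by rewrite (le_lt_trans ac)// lte_fin.
- by rewrite (lt_trans _ sb)// lte_fin.
- by rewrite (lt_trans sa)// lte_fin.
- by rewrite (lt_le_trans _ db)// lte_fin.
Qed.

Lemma fundamental_matrix_solution_on (c d t0 : R) : `[c, d] `<=` oitv a b ->
  c <= t0 <= d -> solution_on A c d t0 (fundamental_matrix A ^~ t0).
Proof.
move=> cdab ct0d.
have [X sX] := solution_on_exists Ameas Abnd t0 cdab.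
have XE := fundamental_matrixE Ameas Abnd cdab ct0d sX.
have [Xt0 lX dX] := sX; split.
- by rewrite -XE.
- move=> i j; have [L L0 H] := lX i j; exists L => // u v cu uv vd.
  by rewrite -!XE ?cu ?vd ?(le_trans cu uv) ?(le_trans uv vd)//; exact: H.
- apply: (ae_imply dX) => t Ht ctd i j.
  (* A derivative at [t] sees only a neighbourhood, on which the separate choices agree with the
     single solution [X]. *)
  have nearE : \forall s \near t, X s i j = fundamental_matrix A s t0 i j.
    have : t \in `]c, d[ by rewrite in_itv.
    move=> /near_in_itvoo; apply: filterS => s; rewrite in_itv/= => /andP[cs sd].
    by rewrite XE// !ltW.
  rewrite -XE; last by case/andP: ctd => /ltW -> /ltW ->.
  by apply: near_eq_is_derive nearE _; exact: Ht.
Qed.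

Lemma fundamental_matrix_transition :
  is_transition_matrix a b A (fundamental_matrix A).
Proof.
move=> t0 abt0; split.
  split.
  - by have [||->] := @fundamental_matrix_solution_on t0 t0 t0;
      [exact: oitv_sub|rewrite lexx|].
  - move=> i j c d cdab; have [cd|dc] := leP c d; last first.
      apply: lipschitz_ac; exists 0 => // u v cu uv vd.
      by have := le_lt_trans (le_trans cu uv) (le_lt_trans vd dc); rewrite ltxx.
    have abc : oitv a b c by apply: cdab; rewrite /= in_itv/= lexx.
    have abd : oitv a b d by apply: cdab; rewrite /= in_itv/= lexx andbT.
    have sub : `[Num.min c t0, Num.max d t0] `<=` oitv a b.
      by apply: oitv_sub; rewrite /Num.min/Num.max; case: ifP.
    have [|_ lX _] := @fundamental_matrix_solution_on _ _ t0 sub.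
      by rewrite ge_min le_max lexx !orbT.
    by apply/lipschitz_ac/(lipschitz_itvS _ _ (lX i j)); rewrite ?ge_min ?le_max lexx.
  - have [q qdense] := exists_dense_seq R.
    (* The equation holds off a null set on each interval around [t0] with endpoints in the dense
       sequence; only countably many null sets are united. *)
    have H k l : \forall t \ae mu, oitv a b (q k) -> oitv a b (q l) ->
        q k < t0 -> t0 < q l -> q k < t < q l -> forall i j,
        is_derive (t : R) 1 (fun s => fundamental_matrix A s t0 i j)
          ((A t *m fundamental_matrix A t t0) i j).
      have [abk|] := pselect (oitv a b (q k)); last by move=> nk; apply: aeW.
      have [abl|] := pselect (oitv a b (q l)); last by move=> nk; apply: aeW.
      have [kt0|] := ltP (q k) t0; last by move=> nk; apply: aeW.
      have [t0l|] := ltP t0 (q l); last by move=> nk; apply: aeW.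
      have [|_ _ dX] := fundamental_matrix_solution_on (oitv_sub abk abl) (t0 := t0).
        by rewrite !ltW.
      by apply: (ae_imply dX) => t Ht _ _ _ _.
    have {}H : \forall t \ae mu, forall k l, oitv a b (q k) -> oitv a b (q l) ->
        q k < t0 -> t0 < q l -> q k < t < q l -> forall i j,
        is_derive (t : R) 1 (fun s => fundamental_matrix A s t0 i j)
          ((A t *m fundamental_matrix A t t0) i j).
      by apply/ae_foralln => k; apply/ae_foralln => l; exact: H.
    apply: (ae_imply H) => t Ht abt.
    have [k [_ [abk _ kt _]]] := oitv_dense abt qdense.
    have [_ [l [_ abl _ tl]]] := oitv_dense abt qdense.
    have [k' [_ [abk' _ kt' _]]] := oitv_dense abt0 qdense.
    have [_ [l' [_ abl' _ tl']]] := oitv_dense abt0 qdense.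
    (* The smaller left endpoint and the larger right one, so that the interval contains both [t]
       and [t0]. *)
    pose k0 := if q k < q k' then k else k'.
    pose l0 := if q l < q l' then l' else l.
    apply: (Ht k0 l0); rewrite /k0 /l0.
    + by case: ifP.
    + by case: ifP.
    + by case: ifPn => // kk; exact: lt_trans kt'.
    + by case: ifPn => //; rewrite -leNgt => ll; exact: lt_le_trans ll.
    + apply/andP; split.
        by case: ifPn => //; rewrite -leNgt => kk; exact: le_lt_trans kt.
      by case: ifPn => // ll; exact: lt_trans ll.
move=> X [Xt0 acX dX] t abt.
have sub : `[Num.min t t0, Num.max t t0] `<=` oitv a b.
  by apply: oitv_sub; rewrite /Num.min/Num.max; case: ifP.
have [M M0 AM] := coeff_ae_bounded Ameas Abnd sub.
have ct0d : Num.min t t0 <= t0 <= Num.max t t0.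
  by rewrite ge_min le_max lexx !orbT.
have [Yt0 lY dY] := fundamental_matrix_solution_on sub ct0d.
apply: (linear_ode_unique ct0d M0 AM _ _ _ _ dY).
- by rewrite Xt0 Yt0.
- by move=> i j; exact: acX.
- by move=> i j; exact: lipschitz_ac.
- apply: (ae_imply dX) => s H /andP[cs sd]; apply: H.
  by apply: sub; rewrite /= in_itv/= !ltW.
- by rewrite ge_min le_max lexx.
Qed.

End TransitionMatrixSpec.

(** * Minors along the flow *)

Section Minors.
Variable R : realType.

Lemma is_derive_bigsum (I : Type) (r : seq I) (F : I -> R -> R) (F' : I -> R) (t : R) :
  (forall i, is_derive t 1 (F i) (F' i)) ->
  is_derive t 1 (fun s => \sum_(i <- r) F i s) (\sum_(i <- r) F' i).
Proof.
move=> dF; elim: r => [|i r IH].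
  by under eq_fun do rewrite big_nil; rewrite big_nil; exact: is_derive_cst.
by under eq_fun do rewrite big_cons; rewrite big_cons; exact: is_deriveD.
Qed.

Lemma is_derive_bigprod (I : eqType) (r : seq I) (F : I -> R -> R) (F' : I -> R) (t : R) :
  uniq r -> (forall i, is_derive t 1 (F i) (F' i)) ->
  is_derive t 1 (fun s => \prod_(i <- r) F i s)
    (\sum_(j <- r) \prod_(i <- r) (if i == j then F' i else F i t)).
Proof.
move=> + dF; elim: r => [|x r IH] /=.
  by under eq_fun do rewrite big_nil; rewrite big_nil => _; exact: is_derive_cst.
move=> /andP[xr ur]; under eq_fun do rewrite big_cons.
have dxr := is_deriveM (dF x) (IH ur).
apply: (is_derive_eq dxr).
rewrite big_cons [in RHS]big_cons eqxx addrC; congr (_ + _).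
  rewrite [_ *: _]mulrC; congr (_ * _); apply: eq_big_seq => i ir.
  by case: eqP => // ix; move: xr; rewrite -ix ir.
rewrite [_ *: _]mulr_sumr; apply: eq_big_seq => j jr.
rewrite big_cons; case: eqP => // xj; by move: xr; rewrite xj jr.
Qed.

Lemma is_derive_det (k : nat) (X : R -> 'M[R]_k) (X' : 'M[R]_k) (t : R) :
  (forall i j, is_derive t 1 (fun s => X s i j) (X' i j)) ->
  is_derive t 1 (fun s => \det (X s))
    (\sum_r \det (\matrix_(i, j) (if i == r then X' i j else X t i j))).
Proof.
move=> dX.
have dprod (s : 'S_k) : is_derive t 1
    (fun u => (-1) ^+ s * \prod_i X u i (s i))
    ((-1) ^+ s * \sum_r \prod_i (if i == r then X' i (s i) else X t i (s i))).
  have := is_derive_bigprod (index_enum_uniq _) (fun i => dX i (s i)).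
  by move=> /(is_deriveZ ((-1) ^+ s)).
apply: (is_derive_eq (is_derive_bigsum _ dprod)).
rewrite /determinant exchange_big/=; apply: eq_bigr => s _.
rewrite mulr_sumr; apply: eq_bigr => r _; congr (_ * _).
by apply: eq_bigr => i _; rewrite mxE.
Qed.

Definition upd k n (f : 'I_k -> 'I_n) r l : 'I_k -> 'I_n :=
  fun i => if i == r then l else f i.

(** In the expansion along row [r] the cofactors do not involve that row, so they are the same for
    every [l]. *)
Lemma det_row_sum (k n : nat) (f : 'I_k -> 'I_n) (g : 'I_k -> 'I_n) (W : 'M[R]_n)
    (a : 'I_n -> R) (r : 'I_k) :
  \det (\matrix_(i, j) (if i == r then \sum_l a l * W l (g j) else W (f i) (g j))) =
  \sum_l a l * \det (mxsub (upd f r l) g W).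
Proof.
rewrite (expand_det_row _ r).
under [RHS]eq_bigr do rewrite (expand_det_row _ r) mulr_sumr.
rewrite exchange_big/=; apply: eq_bigr => j _.
rewrite mxE eqxx mulr_suml; apply: eq_bigr => l _.
rewrite !mxE {1}/upd eqxx [RHS]mulrA; congr (_ * _).
rewrite /cofactor; congr (_ * \det _); apply/matrixP => i' j'.
by rewrite !mxE /upd eq_sym (negbTE (neq_lift _ _)).
Qed.

(** This is the action of the additive compound of [A] on the minors with columns [g]. Allowing
    every map as row index avoids sorting the rows and tracking signs. *)
Lemma is_derive_minor (k n : nat) (f g : 'I_k -> 'I_n) (A : 'M[R]_n)
    (X : R -> 'M[R]_n) (t : R) :
  (forall i j, is_derive t 1 (fun s => X s i j) ((A *m X t) i j)) ->
  is_derive t 1 (fun s => \det (mxsub f g (X s)))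
    (\sum_r \sum_l A (f r) l * \det (mxsub (upd f r l) g (X t))).
Proof.
move=> dX.
have dminor i j : is_derive t 1 (fun s => mxsub f g (X s) i j)
    (mxsub f g (A *m X t) i j).
  by under eq_fun do rewrite mxE; rewrite mxE; exact: dX.
apply: (is_derive_eq (is_derive_det dminor)); apply: eq_bigr => r _.
rewrite -det_row_sum; congr (\det _); apply/matrixP => i j; rewrite !mxE.
by case: eqP => // ->.
Qed.

Section Strict.
Variables k n : nat.
Implicit Types f g : 'I_k -> 'I_n.

Definition strict f := {homo f : i j / (i < j)%N}.

(** An entry moved by one cannot jump over a neighbour; it can only collide with it, which
    injectivity excludes. *)
Lemma strict_upd f r (l : 'I_n) : strict f -> `|(f r)%:Z - l%:Z| = 1 ->
  injective (upd f r l) -> strict (upd f r l).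
Proof.
move=> sf adj inj i j ij.
have /eqP : upd f r l i <> upd f r l j by move=> /inj ijE; move: ij; rewrite ijE ltnn.
rewrite -val_eqE/= /upd; have := sf i j ij.
have [ir|ir] := eqVneq i r; have [jr|jr] := eqVneq j r => //.
- by move: ij; rewrite ir jr ltnn.
- by rewrite ir; move: adj; lia.
- by rewrite jr; move: adj; lia.
Qed.

Lemma upd_upd f r l : upd (upd f r l) r (f r) = f.
Proof. by apply/funext => i; rewrite /upd; case: eqP => // ->. Qed.

Lemma strict_ge f (i : 'I_k) : strict f -> (i <= f i)%N.
Proof.
move=> sf; case: i => m; elim: m => [//|m IH] mk.
apply: leq_ltn_trans (IH (ltnW mk)) _; exact: sf.
Qed.

Lemma strict_inj f : strict f -> injective f.
Proof.
move=> sf i j fij; apply/val_inj/eqP; rewrite eqn_leq.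
by apply/andP; split; rewrite leqNgt; apply/negP => /sf; rewrite fij ltnn.
Qed.

(* Lowering by one the first entry that is not minimal keeps a strictly increasing
   sequence strictly increasing. *)
Lemma strict_lower f : strict f -> ~ (forall i, f i = i :> nat) ->
  exists r (l : 'I_n), [/\ (f r : nat) = l.+1 & strict (upd f r l)].
Proof.
move=> sf nmin.
have /existsP/sigW[i0 Hi0] : [exists i, (f i : nat) != i].
  by apply: contrapT => /negP; rewrite negb_exists => /forallP H; apply: nmin => i;
    have := H i; rewrite negbK => /eqP.
case: (@arg_minnP _ i0 (fun i => (f i : nat) != i) (fun i => i : nat) Hi0) => r Hr minr.
have fr : (r < f r)%N by rewrite ltn_neqAle eq_sym Hr strict_ge.
have lt_l : ((f r).-1 < n)%N by have := ltn_ord (f r); lia.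
exists r, (Ordinal lt_l); split; first by rewrite /=; lia.
apply: strict_upd => //=; first by lia.
have H i : i != r -> (f i : nat) != (f r).-1.
  move=> ir; have [ltir|gtir] : (i < r)%N \/ (r < i)%N.
    by move: ir; rewrite -val_eqE neq_ltn => /orP.
    have -> : (f i : nat) = i.
      by apply/eqP/negPn/negP => /minr; lia.
    lia.
  by have := sf _ _ gtir; lia.
move=> i j; rewrite /upd; case: eqP => [->|/eqP ir]; case: eqP => [->|/eqP jr] //.
- by move=> /(congr1 val)/= E; have := H _ jr; rewrite -E eqxx.
- by move=> /(congr1 val)/= E; have := H _ ir; rewrite E eqxx.
- exact: strict_inj.
Qed.

(** Unit moves lower any strictly increasing sequence to [0, 1, ..., k - 1], by induction on the sum
    of its entries. As [P] is invariant under the moves in both directions, it travels from [g] down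
    to this sequence and up to [f]. *)
Lemma strict_connected (P : ('I_k -> 'I_n) -> Prop) :
  (forall f r (l : 'I_n), strict f -> strict (upd f r l) -> `|(f r)%:Z - l%:Z| = 1 ->
     P f <-> P (upd f r l)) ->
  forall f g, strict f -> strict g -> P g -> P f.
Proof.
move=> HP.
suff H f : strict f -> exists h, [/\ strict h, forall i, h i = i :> nat & P h <-> P f].
  move=> f g /H[h [_ hi hf]] /H[h' [_ hi' hg]] Pg.
  apply/hf; have -> : h = h' by apply/funext => i; apply/val_inj; rewrite /= hi hi'.
  exact/hg.
have [m] := ubnP (\sum_i f i)%N; elim: m f => // m IH f fm sf.
have [min|nmin] := pselect (forall i, f i = i :> nat); first by exists f.
have [r [l [frl su]]] := strict_lower sf nmin.
have adj : `|(f r)%:Z - l%:Z| = 1 by lia.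
have [|h [sh hi hP]] := IH (upd f r l) _ su.
  rewrite (bigD1 r)//= in fm; rewrite (bigD1 r)//= /upd eqxx.
  rewrite (eq_bigr (fun i => nat_of_ord (f i))); first by lia.
  by move=> i /negbTE ->.
exists h; split => //.
exact: iff_trans hP (iff_sym (HP f r l sf su adj)).
Qed.

End Strict.

End Minors.

(** * Positivity of the minors *)

Section Drift.
Variables (R : realType) (k n : nat) (a : 'M[R]_n) (B : R).
Variable p : ('I_k -> 'I_n) -> R.
Hypotheses (Ma : Mplus a) (aB : forall i j, `|a i j| <= B) (B0 : 0 <= B)
  (p0 : forall f, ~ injective f -> p f = 0).

(* Derivative of the minor [p f] along the flow, shifted by [k * B] so that all the
   coefficients become nonnegative. *)
Definition drift (f : 'I_k -> 'I_n) :=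
  \sum_r \sum_l a (f r) l * p (upd f r l) + k%:R * B * p f.

(** The shift [k * B] is spread as one [B] over each of the [k] rows, making every diagonal
    coefficient nonnegative. *)
Lemma driftE f : drift f =
  \sum_r ((a (f r) (f r) + B) * p f + \sum_(l | l != f r) a (f r) l * p (upd f r l)).
Proof.
rewrite /drift -mulrA mulr_natl -[in B * _ *+ _](card_ord k) -sumr_const -big_split/=.
apply: eq_bigr => r _; rewrite (bigD1 (f r))//=.
have -> : upd f r (f r) = f by apply/funext => i; rewrite /upd; case: eqP => // ->.
by ring.
Qed.

Lemma coupling_ge f r (l : 'I_n) s : strict f -> l != f r -> 0 <= s ->
  (forall h, strict h -> - s <= p h) -> - (B * s) <= a (f r) l * p (upd f r l).
Proof.
move=> sf lfr s0 ps; have [apos azero] := Ma.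
have [adj|far] : `|(f r)%:Z - l%:Z| = 1 \/ 1 < `|(f r)%:Z - l%:Z|.
  by move: lfr; rewrite -val_eqE/=; lia.
  have a0 := apos _ _ adj.
  have [inj|/p0 ->] := pselect (injective (upd f r l)); last first.
    by rewrite mulr0 oppr_le0 mulr_ge0.
  have := ps _ (strict_upd sf adj inj); rewrite -(ler_pM2l a0); apply: le_trans.
  by rewrite mulrN lerN2 ler_wpM2r// (le_trans (ler_norm _)).
by rewrite azero// mul0r oppr_le0 mulr_ge0.
Qed.

Lemma diagonal_ge f r s : 0 <= s -> - s <= p f ->
  - (2 * B * s) <= (a (f r) (f r) + B) * p f.
Proof.
move=> s0 ps; have := aB (f r) (f r); rewrite ler_norml => /andP[a1 a2].
have aB0 : 0 <= a (f r) (f r) + B by rewrite -lerBlDr sub0r.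
apply: (le_trans _ (ler_wpM2l aB0 ps)); rewrite mulrN lerN2 ler_wpM2r//.
by rewrite mulr_natl mulr2n lerD2r.
Qed.

(** Each of the [k] rows costs at most [2 * B] for the shifted diagonal and, counted crudely, [B]
    for each of [n] possible couplings: hence [n.+2]. *)
Lemma drift_ge f s : strict f -> 0 <= s -> (forall h, strict h -> - s <= p h) ->
  - (k%:R * (n.+2%:R * B) * s) <= drift f.
Proof.
move=> sf s0 ps; rewrite driftE.
have -> : - (k%:R * (n.+2%:R * B) * s) = \sum_(r < k) - (n.+2%:R * B * s).
  by rewrite sumr_const card_ord -mulr_natl; ring.
apply: ler_sum => r _.
have -> : - (n.+2%:R * B * s) = - (2 * B * s) + - (n%:R * B * s).
  by rewrite -addn2 natrD; ring.
apply: lerD; first by apply: diagonal_ge => //; exact: ps.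
apply: (@le_trans _ _ (\sum_(l | l != f r) - (B * s))); last first.
  by apply: ler_sum => l lfr; exact: coupling_ge.
rewrite sumrN lerN2 -mulrA mulr_natl -[in leRHS](card_ord n) -sumr_const.
by rewrite [leRHS](bigD1 (f r))//= lerDr mulr_ge0.
Qed.

Lemma drift_ge_coupling f r (l : 'I_n) : strict f -> l != f r ->
  (forall h, strict h -> 0 <= p h) -> a (f r) l * p (upd f r l) <= drift f.
Proof.
move=> sf lfr p_ge0.
have c0 r' l' : l' != f r' -> 0 <= a (f r') l' * p (upd f r' l').
  move=> lfr'; have := @coupling_ge f r' l' 0 sf lfr' (lexx _).
  by rewrite mulr0 oppr0; exact.
have d0 r' : 0 <= (a (f r') (f r') + B) * p f.
  have := @diagonal_ge f r' 0 (lexx _).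
  by rewrite mulr0 oppr0; apply; exact: p_ge0.
rewrite driftE (bigD1 r)//= (bigD1 l)//= addrA addrAC [_ + a _ _ * _]addrC -!addrA lerDl.
rewrite addr_ge0// addr_ge0//.
  apply: sumr_ge0 => r' _; rewrite addr_ge0//; apply: sumr_ge0 => l' lfr'.
  exact: c0.
by apply: sumr_ge0 => l' /andP[lfr' _]; exact: c0.
Qed.

End Drift.

Section InitialMinors.
Variables (R : realType) (k n : nat).
Implicit Types f g : 'I_k -> 'I_n.

(** [s] permutes the indices, so it preserves their sum, while [i <= s i] holds termwise. *)
Lemma strict_endo_id (s : 'I_k -> 'I_k) : strict s -> forall i, s i = i.
Proof.
move=> ss i; apply/val_inj/eqP; rewrite eqn_leq; apply/andP; split; last exact: strict_ge.
rewrite leqNgt; apply/negP => /= ltis.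
have : (\sum_i s i = \sum_(i < k) i)%N.
  by rewrite [RHS](reindex_inj (strict_inj ss)).
rewrite (bigD1 i)//= [in RHS](bigD1 i)//=.
have : (\sum_(j < k | j != i) j <= \sum_(j | j != i) s j)%N.
  by apply: leq_sum => j _; exact: strict_ge.
by move=> /(leq_add ltis) + eqs; rewrite eqs addSn ltnn.
Qed.

Lemma minor1 f : strict f -> \det (mxsub f f (1%:M : 'M[R]_n)) = 1.
Proof.
move=> /strict_inj finj; rewrite -[RHS](det1 R k); congr (\det _).
by apply/matrixP => i j; rewrite !mxE (inj_eq finj).
Qed.

(** If some [f i] is not a value of [g], row [i] is zero. Otherwise [f] is [g] composed with a
    strictly increasing self-map of the indices, which is the identity, so the minor is 1. *)
Lemma minor1_ge0 f g : strict f -> strict g -> 0 <= \det (mxsub f g (1%:M : 'M[R]_n)).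
Proof.
move=> sf sg.
have [H|/existsNP[i Hi]] := pselect (forall i, exists j, f i = g j); last first.
  rewrite (expand_det_row _ i) big1// => j _; rewrite !mxE.
  by case: eqP => [fg|_]; [case: Hi; exists j|rewrite mul0r].
have [s Hs] := choice H.
have ss : strict s.
  move=> i j ij; rewrite ltnNge; apply/negP => sji.
  have := sf i j ij; rewrite !Hs ltnNge => /negP; apply.
  by move: sji; rewrite leq_eqVlt => /orP[/eqP/val_inj ->//|/sg/ltnW].
have -> : f = g by apply/funext => i; rewrite Hs strict_endo_id.
by rewrite minor1.
Qed.

End InitialMinors.

(** * Nonnegativity, monotonicity and strict positivity of the weighted minors *)

Section Positivity.
Variables (R : realType) (n : nat).
Local Notation mu := (@lebesgue_measure R).
Variables (c d M delta : R) (A X : R -> 'M[R]_n).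
Hypotheses (cd : c < d) (M0 : 0 <= M) (delta0 : 0 < delta)
  (Xc : X c = 1%:M) (lX : forall i j, lipschitz_itv c d (fun t => X t i j))
  (dX : \forall t \ae mu, c < t < d -> forall i j,
    is_derive (t : R) 1 (fun s => X s i j) ((A t *m X t) i j))
  (AM : \forall t \ae mu, c < t < d -> forall i j, `|A t i j| <= M)
  (Ap : \forall t \ae mu, c < t < d -> Mplus (A t))
  (Ad : \forall t \ae mu, c < t < d ->
    forall i j : 'I_n, `|i%:Z - j%:Z| = 1 -> delta <= A t i j).

Lemma det_mxsub_not_inj (k : nat) (f g : 'I_k -> 'I_n) (W : 'M[R]_n) :
  ~ injective f -> \det (mxsub f g W) = 0.
Proof.
move=> ninj; apply: contrapT => detn0; apply: ninj => i j fij.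
apply/eqP/negPn/negP => ij; apply: detn0.
by apply: (determinant_alternate ij) => l; rewrite !mxE fij.
Qed.

Variables (k : nat) (g : 'I_k -> 'I_n).
Hypothesis sg : strict g.

Let p t (f : 'I_k -> 'I_n) := \det (mxsub f g (X t)).
(** The rate is the shift in [drift] for [B = M], so the derivative of the weighted minor is exactly
    [w t] times its drift. *)
Let C := k%:R * M.
Let w t := 1 * expR (C * (t - c)).
Let q t f := w t * p t f.

Let w0 t : 0 < w t.
Proof. by rewrite /w mul1r expR_gt0. Qed.

Let q_lipschitz f : lipschitz_itv c d (q ^~ f).
Proof.
apply: lipschitz_itvM; first exact: lipschitz_expRZ.
apply: lipschitz_itv_sum => s; apply: lipschitz_itvM.
  exact: lipschitz_itv_cst.
apply: lipschitz_itv_prod => i.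
by under eq_fun do rewrite mxE; exact: lX.
Qed.

Let q_derive : \forall t \ae mu, c < t < d -> forall f,
  is_derive (t : R) 1 (q ^~ f) (w t * drift (A t) M (p t) f).
Proof.
apply: (ae_imply dX) => t dXt ctd f.
have dp := is_derive_minor f g (dXt ctd).
have dw : is_derive t 1 w (1 * C * expR (C * (t - c))) by exact: is_derive_expRZ.
apply: (is_derive_eq (is_deriveM dw dp)).
rewrite /drift -/(p t f) [X in X + _ = _]mulrC [X in _ + X = _]mulrC /w.
set D := (X in _ = _ * (X + _)); rewrite -[X in X * _ + _ = _]/D /C; ring.
Qed.

Let ae_facts : \forall t \ae mu, c < t < d ->
  [/\ forall i j, `|A t i j| <= M, Mplus (A t),
    forall i j : 'I_n, `|i%:Z - j%:Z| = 1 -> delta <= A t i j &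
    forall f, is_derive (t : R) 1 (q ^~ f) (w t * drift (A t) M (p t) f)].
Proof.
apply: (ae_imply (ae_and (ae_and AM Ap) (ae_and Ad q_derive))).
by move=> t [[h1 h2] [h3 h4]] ctd; split; auto.
Qed.

Let p0 t f : ~ injective f -> p t f = 0.
Proof. exact: det_mxsub_not_inj. Qed.

Let qc f : q c f = \det (mxsub f g (1%:M : 'M[R]_n)).
Proof. by rewrite /q /p Xc /w subrr mulr0 expR0 !mul1r. Qed.

Let q_ge0 f t : strict f -> c <= t <= d -> 0 <= q t f.
Proof.
move=> sf ctd.
(* Finite functions form a finite type, over which the bounds can be summed into one. *)
pose b (h : {ffun 'I_k -> 'I_n}) := sval (cid2 (lipschitz_itv_bounded (q_lipschitz h))).
have b0 h : 0 <= b h by rewrite /b; case: cid2.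
pose I := {h : 'I_k -> 'I_n | strict h}.
have KM0 : 0 <= k%:R * (n.+2%:R * M) by rewrite !mulr_ge0.
have b_ge0 : 0 <= \sum_h b h by exact: sumr_ge0.
apply: (@ac_linear_ge0 R I c d _ _ (fun h t => q t (sval h)) (ltW cd) KM0 b_ge0
  _ _ _ _ (exist _ f sf)) => // {ctd t sf f}.
- by move=> h; exact: lipschitz_ac.
- by move=> [h sh] /=; rewrite qc minor1_ge0.
- move=> [h sh] t ctd /=; have : `|q t h| <= \sum_h b h.
    apply: (@le_trans _ _ (b [ffun i => h i])).
      rewrite /b; case: cid2 => B /= _ /(_ t ctd).
      by have -> : ([ffun i => h i] : 'I_k -> 'I_n) = h
        by apply/funext => i; rewrite ffunE.
    by rewrite (bigD1 [ffun i => h i])//= lerDl sumr_ge0.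
  by rewrite ler_norml => /andP[].
- apply: (ae_imply ae_facts) => t Ht ctd [h sh] /=.
  have [AMt Apt _ dq] := Ht ctd.
  exists (w t * drift (A t) M (p t) h); first exact: dq.
  move=> s s0 qs.
  have ws : 0 <= s / w t by rewrite divr_ge0// ltW.
  have := drift_ge Apt AMt M0 (p0 t) sh ws.
  rewrite -(ler_pM2l (w0 t)).
  have -> : w t * - (k%:R * (n.+2%:R * M) * (s / w t)) = - (k%:R * (n.+2%:R * M) * s).
    by field; rewrite gt_eqF.
  apply => h' sh'; rewrite lerNl ler_pdivlMr// mulNr lerNl mulrC.
  exact: (qs (exist _ h' sh')).
Qed.

Let p_ge0 f t : strict f -> c <= t <= d -> 0 <= p t f.
Proof. by move=> sf ctd; have := q_ge0 sf ctd; rewrite /q pmulr_rge0. Qed.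

Let q_mono f u v : strict f -> c <= u -> u <= v -> v <= d -> q u f <= q v f.
Proof.
move=> sf cu uv vd; apply: (@ac_nondecreasing _ u v (q ^~ f) uv).
  exact/lipschitz_ac/(lipschitz_itvS cu vd).
apply: (ae_imply ae_facts) => t Ht /andP[ut tv].
have ctd : c < t < d by rewrite (le_lt_trans cu ut) (lt_le_trans tv vd).
have [AMt Apt _ dq] := Ht ctd.
exists (w t * drift (A t) M (p t) f); first exact: dq.
rewrite mulr_ge0//; first exact: ltW.
(* With all minors nonnegative, the case [s = 0] says that the drift is nonnegative. *)
have := drift_ge Apt AMt M0 (p0 t) sf (lexx 0); rewrite mulr0 oppr0; apply.
by move=> h sh; apply: p_ge0 => //; case/andP: ctd => /ltW -> /ltW ->.
Qed.

(* Once an adjacent minor is positive, its coupling, bounded below by [delta],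
   forces linear growth. *)
Let q_spread f r (l : 'I_n) : strict f -> strict (upd f r l) ->
  `|(f r)%:Z - l%:Z| = 1 ->
  (forall t, c < t <= d -> 0 < q t (upd f r l)) -> forall t, c < t <= d -> 0 < q t f.
Proof.
move=> sf su adj qu t /andP[ct td].
set h := upd f r l in su qu *.
(* The neighbour [h] may vanish at [c], so growth is only counted from the midpoint on. There
   [q s h] stays above [q m h] by monotonicity, which gives the slope [e = delta * q m h]. *)
pose m := (c + t) / 2.
have cm : c < m by rewrite /m; lra.
have mt : m < t by rewrite /m; lra.
have qm0 : 0 <= q m f by apply: q_ge0 => //; rewrite (ltW cm) (le_trans (ltW mt)).
have qh0 : 0 < q m h by apply: qu; rewrite cm (le_trans (ltW mt)).
pose e := delta * q m h.
have e0 : 0 < e by rewrite mulr_gt0.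
have de s : is_derive (s : R) 1 (fun s => e * s) e.
  have -> : (fun s : R => e * s) = e \*: (id : R -> R) by [].
  by apply: is_derive_eq; rewrite [_ *: _]mulr1.
have : e * t - e * m <= q t f - q m f.
  apply: (@ac_comparison _ m t (q ^~ f) (fun s => e * s) (fun=> e)) => //.
  - exact: ltW.
  - by apply/lipschitz_ac/(lipschitz_itvS (ltW cm) td).
  - by apply: (@lipschitz_itv_derive _ _ _ _ (fun=> e) `|e|).
  apply: (ae_imply ae_facts) => s Hs /andP[ms st].
  have csd : c < s < d by rewrite (lt_trans cm ms) (lt_le_trans st td).
  have [AMt Apt Adt dq] := Hs csd.
  exists (w s * drift (A s) M (p s) f); first exact: dq.
  have csd' : c <= s <= d by case/andP: csd => /ltW -> /ltW ->.
  have lfr : l != f r by apply/eqP => lf; move: adj; rewrite lf subrr normr0.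
  have := drift_ge_coupling Apt AMt M0 (p0 s) sf lfr (fun h sh => p_ge0 sh csd').
  rewrite -(ler_pM2l (w0 s)); apply: le_trans.
  rewrite mulrCA -/(q s (upd f r l)) -/h.
  apply: ler_pM; [exact: ltW|exact: ltW|exact: Adt|].
  by apply: q_mono => //; [exact: ltW|exact: ltW|case/andP: csd'].
have : 0 < e * (t - m) by rewrite mulr_gt0// subr_gt0.
by rewrite mulrBr; lra.
Qed.

Let q_gt0 f : strict f -> forall t, c < t <= d -> 0 < q t f.
Proof.
move=> sf.
apply: (@strict_connected k n (fun f => forall t, c < t <= d -> 0 < q t f) _ f g) => //.
  move=> {sf}f r l sf su adj; split; last exact: q_spread.
  (* The entries on both sides of the diagonal are bounded below by [delta], so positivity also
     spreads along the reversed move. *)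
  have E : upd (upd f r l) r (f r) = f by exact: upd_upd.
  move=> qf; apply: (@q_spread _ r (f r)) => //; rewrite ?E//.
  by rewrite /upd eqxx distrC.
move=> t /andP[ct td]; apply: (@lt_le_trans _ _ (q c g)).
  by rewrite qc minor1.
by apply: q_mono => //; exact: ltW.
Qed.

Lemma solution_minor_gt0 f : strict f -> 0 < \det (mxsub f g (X d)).
Proof.
move=> sf; have : 0 < q d f by apply: q_gt0; rewrite ?cd ?lexx.
by rewrite /q pmulr_rgt0.
Qed.

End Positivity.

Theorem theorem8 (R : realType) (n : nat) (a b : \bar R) (hab : (a < b)%E)
  (A : R -> 'M[R]_n)
  (Ameas : forall i j, lebesgue_measurable_fun (oitv a b) (fun t => A t i j))
  (Abnd : forall i j, locally_ess_bounded (oitv a b) (fun t => A t i j))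
  (AMplus : \forall t \ae (@lebesgue_measure R), oitv a b t -> Mplus (A t))
  (Adelta : exists2 delta : R, 0 < delta &
     \forall t \ae (@lebesgue_measure R), oitv a b t ->
       forall i j : 'I_n, `|i%:Z - j%:Z| = 1 -> delta <= A t i j) :
  TPDS a b A.
Proof.
exists (fundamental_matrix A); first exact: fundamental_matrix_transition.
move=> t0 t abt0 abt t0t k f g sf sg.
have sub : `[t0, t] `<=` oitv a b by exact: oitv_sub.
have subo s : t0 < s < t -> oitv a b s.
  by move=> /andP[t0s st]; apply: sub; rewrite /= in_itv/= !ltW.
have [|Pt0 lP dP] := fundamental_matrix_solution_on Ameas Abnd sub (t0 := t0).
  by rewrite lexx ltW.
have [M M0 AM] := coeff_ae_bounded Ameas Abnd sub.
have [delta delta0 Ad] := Adelta.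
apply: (@solution_minor_gt0 R n t0 t M delta A (fundamental_matrix A ^~ t0) t0t M0
  delta0 Pt0 lP dP _ _ _ k g sg f sf).
- by apply: (ae_imply AM) => s H /andP[t0s st]; apply: H; rewrite !ltW.
- by apply: (ae_imply AMplus) => s H /subo.
- by apply: (ae_imply Ad) => s H /subo.
Qed.
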